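(* Let $I_{\mathcal{L}}$ be the lattice ideal of $\mathcal{L}$. For every $\mathbf{b}\in\mathcal{A}$ and every $i\ge 0$, $$\beta_{i,\mathbf{b}}(R/I_{\mathcal{L}})=\dim_{\Bbbk}\tilde{H}_{i-1}(\Delta_{\gcd}(\mathbf{b});\Bbbk).$$
   Context: Let $\mathcal{L}\subset\mathbb{Z}^n$ be a lattice (subgroup) with $\mathcal{L}\cap\mathbb{N}^n=\{\mathbf{0}\}$, and let $\mathcal{A}$ be the subsemigroup (containing $0$) of $\mathbb{Z}^n/\mathcal{L}$ generated by $\mathbf{a}_i=\mathbf{e}_i+\mathcal{L}$, $1\le i\le n$, where $\mathbf e_1,\dots,\mathbf e_n$ is the canonical basis of $\mathbb{Z}^n$. Let $\Bbbk$ be a field and $R=\Bbbk[x_1,\dots,x_n]$, multigraded by $\mathcal{A}$ via $\deg_{\mathcal{A}}(\mathbf{x}^{\mathbf{v}})=v_1\mathbf{a}_1+\cdots+v_n\mathbf{a}_n$. The lattice ideal $I_{\mathcal{L}}$ is generated by all binomials $\mathbf{x}^{\mathbf{u}_+}-\mathbf{x}^{\mathbf{u}_-}$ with $\mathbf{u}_+,\mathbf{u}_-\in\mathbb{N}^n$ and $\mathbf{u}_+-\mathbf{u}_-\in\mathcal{L}$; it is $\mathcal{A}$-homogeneous. The $i$-Betti number of $\mathcal{A}$-degree $\mathbf{b}$ is $\beta_{i,\mathbf{b}}(R/I_{\mathcal{L}})=\dim_{\Bbbk}\operatorname{Tor}_i^R(R/I_{\mathcal{L}},\Bbbk)_{\mathbf{b}}$.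 For $\mathbf{b}\in\mathcal{A}$ the fiber is the (finite) set of monomials $C_{\mathbf{b}}=\{\mathbf{x}^{\mathbf{u}}:\deg_{\mathcal{A}}(\mathbf{x}^{\mathbf{u}})=\mathbf{b}\}$. The gcd-complex $\Delta_{\gcd}(\mathbf{b})$ is the simplicial complex on vertex set $C_{\mathbf{b}}$ whose faces are the empty set and all nonempty subsets $T\subset C_{\mathbf{b}}$ with $\gcd(\mathbf{x}^{\mathbf{a}}:\mathbf{x}^{\mathbf{a}}\in T)\ne1$. (For $\mathbf{b}\neq 0$ every singleton is a face; for $\mathbf{b}=0$ the only face is $\emptyset$.) $\tilde H_j$ denotes reduced simplicial homology; the complex whose only face is $\emptyset$ has $\tilde{H}_{-1}=\Bbbk$ and all its other reduced homology zero. *)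

(* Defs.v *)
(* MathComp, with finmap and multinomials; boolp supplies classical booleans. *)
From HB Require Import structures.
From mathcomp Require Import all_boot all_order all_algebra.
From mathcomp Require Import finmap freeg mpoly boolp.

Set Implicit Arguments.
Unset Strict Implicit.
Unset Printing Implicit Defensive.

Import Order.TTheory GRing.Theory.
Import Quotient.

Local Open Scope ring_scope.
Local Open Scope quotient_scope.

Section Dimension.
Variables (k : fieldType) (V : lmodType k).

(* Z / B has dimension d: some d vectors of Z form a basis of Z modulo B. *)
Definition has_dim_quotient (Z B : V -> Prop) (d : nat) : Prop :=
  exists e : 'I_d -> V,
    [/\ forall j, Z (e j),
        forall z, Z z -> exists c : 'I_d -> k, B (z - \sum_j c j *: e j)
      & forall c : 'I_d -> k, B (\sum_j c j *: e j) -> forall j, c j = 0].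

End Dimension.

Section SimplicialHomology.
Context {disp : Order.disp_t} {V : orderType disp}.

(* A singleton of V need not be a face. *)
Record simplicial_complex := SimplicialComplex {
  face :> {fset V} -> Prop;
  face0 : face fset0;
  face_subset : forall S T : {fset V}, (S `<=` T)%fset -> face T -> face S
}.

Variables (k : fieldType) (D : simplicial_complex).

(* A face T has dimension #|T| - 1, so the empty face has dimension -1. *)
Definition chain (j : int) (c : {freeg {fset V} / k}) : Prop :=
  forall T, T \in dom c -> face D T /\ (#|` T|)%:Z = j + 1.

Definition boundary : {freeg {fset V} / k} -> {freeg {fset V} / k} :=
  fglift (fun T : {fset V} =>
    \sum_(v <- T)
      (-1) ^+ #|` [fset w in T | (w < v)%O]%fset| *: << (T `\ v)%fset >>).

Definition reduced_homology_dim (j : int) (d : nat) : Prop :=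
  has_dim_quotient
    (fun c => chain j c /\ boundary c = 0)
    (fun c => exists2 c', chain (j + 1) c' & c = boundary c') d.

End SimplicialHomology.

Arguments simplicial_complex {disp} V.
Arguments reduced_homology_dim {disp V} k D j d.

Section IdealSpan.
Variable R : comNzRingType.

Definition ideal_span (S : R -> Prop) : {pred R} := fun p =>
  `[< exists2 s : seq (R * R),
        forall t, t \in s -> S t.2 & p = \sum_(t <- s) t.1 * t.2 >].

Lemma ideal_spanP (S : R -> Prop) p :
  reflect (exists2 s : seq (R * R),
             forall t, t \in s -> S t.2 & p = \sum_(t <- s) t.1 * t.2)
          (p \in ideal_span S).
Proof. exact: asboolP. Qed.

Lemma ideal_span0 (S : R -> Prop) : 0 \in ideal_span S.
Proof. by apply/ideal_spanP; exists [::]; rewrite ?big_nil. Qed.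

Lemma ideal_spanMD (S : R -> Prop) a :
  {in ideal_span S &, forall u v, a * u + v \in ideal_span S}.
Proof.
move=> u v /ideal_spanP[s Ss ->] /ideal_spanP[s' Ss' ->].
apply/ideal_spanP; exists ([seq (a * t.1, t.2) | t <- s] ++ s').
  by move=> t; rewrite mem_cat => /orP[/mapP[t' /Ss ? ->]|/Ss'].
rewrite big_cat big_map /= big_distrr /=; congr (_ + _).
by apply: eq_bigr => t _; rewrite mulrA.
Qed.

End IdealSpan.

Section QuotientModule.
Variables (R : comNzRingType) (I : idealr R).

Definition quot_scale (a : R) (x : {ideal_quot I}) : {ideal_quot I} :=
  \pi_{ideal_quot I} a * x.

Lemma quot_scaleA a b x : quot_scale a (quot_scale b x) = quot_scale (a * b) x.
Proof. by rewrite /quot_scale rmorphM mulrA. Qed.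

Lemma quot_scale1 : left_id 1 quot_scale.
Proof. by move=> x; rewrite /quot_scale rmorph1 mul1r. Qed.

Lemma quot_scaleDr : right_distributive quot_scale +%R.
Proof. by move=> a x y; rewrite /quot_scale mulrDr. Qed.

Lemma quot_scaleDl x : {morph quot_scale^~ x : a b / a + b}.
Proof. by move=> a b; rewrite /quot_scale rmorphD mulrDl. Qed.

HB.instance Definition _ := GRing.Zmodule_isLmodule.Build R {ideal_quot I}
  quot_scaleA quot_scale1 quot_scaleDr quot_scaleDl.

End QuotientModule.

Section LatticeGrading.
Variables (n : nat) (L : zmodClosed 'rV[int]_n).

Definition exponent (u : 'X_{1..n}) : 'rV[int]_n := \row_i (u i)%:Z.

Definition gen (i : 'I_n) : {quot L} := \pi_{quot L} (delta_mx 0 i).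

Definition degA (u : 'X_{1..n}) : {quot L} := (\sum_i gen i *+ u i)%R.

Definition in_semigroup (b : {quot L}) : Prop :=
  exists c : 'I_n -> nat, b = (\sum_i gen i *+ c i)%R.

Definition fiber (b : {quot L}) (u : 'X_{1..n}) : Prop := degA u = b.

End LatticeGrading.

Section GcdComplex.
Variables (n : nat) (L : zmodClosed 'rV[int]_n).

Definition mgcd (u v : 'X_{1..n}) : 'X_{1..n} :=
  [multinom minn (u i) (v i) | i < n].

(* The head serves as default value because mgcd has no neutral element; it
   leaves the gcd of a nonempty sequence unchanged. *)
Definition mgcds (s : seq 'X_{1..n}) : 'X_{1..n} :=
  \big[mgcd/head 0%MM s]_(u <- s) u.

(* A monomial is represented by its exponent, so 0%MM stands for 1. *)
Definition gcd_face (b : {quot L}) (T : {fset 'X_{1..n}}) : Prop :=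
  T = fset0 \/
  [/\ T != fset0, forall u, u \in T -> fiber b u & mgcds T <> 0%MM].

Lemma mgcds_eq0 (s : seq 'X_{1..n}) : s != [::] ->
  mgcds s = 0%MM <-> forall i : 'I_n, exists2 u, u \in s & u i = 0%N.
Proof.
move=> s_neq0.
have step i (t : seq 'X_{1..n}) (x : 'X_{1..n}) :
    (\big[mgcd/x]_(u <- t) u) i = 0%N <-> exists2 u, u \in x :: t & u i = 0%N.
  elim: t => [|y t IH].
    rewrite big_nil; split=> [xi|[u]]; first by exists x; rewrite ?mem_head.
    by rewrite inE => /eqP ->.
  rewrite big_cons mnmE; split.
    move=> /eqP; rewrite -leqn0 geq_min !leqn0 => /orP[/eqP yi|/eqP/IH[u]].
      by exists y; rewrite // !inE eqxx orbT.
    rewrite inE => /orP[/eqP ->|ut] ui; first by exists x; rewrite ?mem_head.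
    by exists u; rewrite // !inE ut !orbT.
  case=> u; rewrite !inE => /or3P[/eqP->|/eqP->|ut] ui.
  - by apply/eqP; rewrite -leqn0 geq_min !leqn0 orbC (IH.2 _) //; exists x;
      rewrite ?mem_head.
  - by rewrite ui min0n.
  - apply/eqP; rewrite -leqn0 geq_min !leqn0 orbC (IH.2 _) //; exists u => //.
    by rewrite inE ut orbT.
have headE : head 0%MM s :: s =i s.
  by case: s s_neq0 => //= x s _ y; rewrite !inE orbA orbb.
split=> [s0 i|s0].
  have /step[u] : mgcds s i = 0%N by rewrite s0 mnm0E.
  by rewrite headE; exists u.
apply/mnmP => i; rewrite mnm0E; apply/step.
by have [u us ui] := s0 i; exists u; rewrite // headE.
Qed.

Lemma gcd_face_subset b (S T : {fset 'X_{1..n}}) :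
  (S `<=` T)%fset -> gcd_face b T -> gcd_face b S.
Proof.
have ne0 (U : {fset 'X_{1..n}}) : U != fset0 -> (U : seq _) != [::].
  by move=> U0; rewrite -size_eq0 cardfs_eq0.
move=> /fsubsetP ST faceT; have [->|S0] := eqVneq S fset0; first by left.
case: faceT => [T0|[T0 fibT gcdT]].
  by case/fset0Pn: S0 => u /ST; rewrite T0 inE.
right; split=> // [u /ST|]; first exact: fibT.
move/(mgcds_eq0 (ne0 _ S0)) => gcdS; apply: gcdT.
apply/(mgcds_eq0 (ne0 _ T0)) => i.
by have [u /ST uT ui] := gcdS i; exists u.
Qed.

Definition gcd_complex (b : {quot L}) : simplicial_complex 'X_{1..n} :=
  SimplicialComplex (or_introl erefl : gcd_face b fset0) (@gcd_face_subset b).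

End GcdComplex.

Section LatticeIdeal.
Variables (k : fieldType) (n : nat) (L : zmodClosed 'rV[int]_n).

Definition lattice_binomial (p : {mpoly k[n]}) : Prop :=
  exists u v : 'X_{1..n},
    exponent u - exponent v \in L /\ p = 'X_[u] - 'X_[v].

Definition lattice_ideal : {pred {mpoly k[n]}} := ideal_span lattice_binomial.

Lemma lattice_ideal1 : 1 \notin lattice_ideal.
Proof.
apply/negP => /ideal_spanP[s Ss] /(congr1 (meval (fun=> 1))) /eqP.
rewrite rmorph1 rmorph_sum big_seq big1 ?oner_eq0 //= => t /Ss[u [v [_ ->]]].
rewrite rmorphM rmorphB /= !mevalX !big1 ?subrr ?mulr0 // => i _;
  exact: expr1n.
Qed.

HB.instance Definition _ := isIdealr.Build {mpoly k[n]} lattice_ideal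
  (And3 (ideal_span0 _) lattice_ideal1 (@ideal_spanMD _ _)).

Definition lattice_ring : lmodType {mpoly k[n]} := {ideal_quot lattice_ideal}.

Definition poly_homog (b : {quot L}) (p : {mpoly k[n]}) : Prop :=
  forall m, m \in msupp p -> degA L m = b.

Definition lattice_ring_homog (b : {quot L}) (x : lattice_ring) : Prop :=
  exists2 p, poly_homog b p & x = \pi_{ideal_quot lattice_ideal} p.

End LatticeIdeal.

Section Tor.
Variables (k : fieldType) (n : nat) (L : zmodClosed 'rV[int]_n).
Local Notation R := {mpoly k[n]}.

(* Degree b part of the free R-module on B, the basis element e having
   degree deg e. *)
Definition free_homog (B : choiceType) (deg : B -> {quot L}) (b : {quot L})
    (x : {freeg B / R}) : Prop :=
  forall e m, m \in msupp (coeff e x) -> degA L m + deg e = b.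

(* Resolutions of M by A-graded free R-modules of arbitrary rank; gr b is
   the degree b part of M. *)
Record graded_free_resolution (M : lmodType R) (gr : {quot L} -> M -> Prop) :=
  GradedFreeResolution {
    basis : nat -> choiceType;
    bdeg : forall i, basis i -> {quot L};
    augm : {linear {freeg (basis 0) / R} -> M};
    diff : forall i,
      {linear {freeg (basis i.+1) / R} -> {freeg (basis i) / R}};
    bdegP : forall i (e : basis i), in_semigroup (bdeg e);
    augm_homog : forall b x, free_homog (@bdeg 0) b x -> gr b (augm x);
    diff_homog : forall i b x,
      free_homog (@bdeg i.+1) b x -> free_homog (@bdeg i) b (diff i x);
    augm_surj : forall y, exists x, augm x = y;
    augm_exact : forall x, augm x = 0 <-> exists y, x = diff 0 y;
    diff_exact : forall i x, diff i x = 0 <-> exists y, x = diff i.+1 y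
  }.

(* The residue field k = R / (x_1, ..., x_n) is an R-module through evaluation
   at the origin, and F tensor k, for F free on B, is the k-space on B. *)
Definition reduce_mod (B : choiceType) (x : {freeg B / R}) : {freeg B / k} :=
  \sum_(e <- dom x) << (coeff e x).@[fun=> 0] *g e >>.

Definition tensor_k (B C : choiceType) (f : {freeg B / R} -> {freeg C / R}) :
    {freeg B / k} -> {freeg C / k} :=
  fglift (fun e => reduce_mod (f << e >>)).

Section Homology.
Variables (M : lmodType R) (gr : {quot L} -> M -> Prop).
Variable F : graded_free_resolution gr.

Definition tensor_homog i (b : {quot L}) (z : {freeg (basis F i) / k}) : Prop :=
  forall e, e \in dom z -> bdeg e = b.

Definition tensor_cycle i : {freeg (basis F i) / k} -> Prop :=
  match i with
  | 0 => fun=> True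
  | j.+1 => fun z => tensor_k (diff F j) z = 0
  end.

Definition tensor_homology_dim (i : nat) (b : {quot L}) (d : nat) : Prop :=
  has_dim_quotient
    (fun z : {freeg (basis F i) / k} => tensor_homog b z /\ tensor_cycle z)
    (fun z => exists2 y, tensor_homog b y & z = tensor_k (diff F i) y) d.

End Homology.

(* dim Tor_i(M, k)_b = d. The first conjunct keeps the second from being
   vacuous. *)
Definition Tor_dim (M : lmodType R) (gr : {quot L} -> M -> Prop)
    (i : nat) (b : {quot L}) (d : nat) : Prop :=
  inhabited (graded_free_resolution gr) /\
  forall F : graded_free_resolution gr, tensor_homology_dim F i b d.

Definition betti_number (i : nat) (b : {quot L}) (d : nat) : Prop :=
  Tor_dim (@lattice_ring_homog k n L) i b d.

End Tor.

(* Main.v *)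
(* The subsets of a fiber C_b are the faces of a full simplex, and multiplication
   by x^m maps faces over b to faces over b + deg x^m. Dividing by the gcd, every
   nonempty face is uniquely x^m T with gcd(T) = 1, so the chains of dimension i
   of all these simplices together form a graded free R-module G_i on the sets T
   (cells) with i + 1 elements and gcd 1. In each degree G is the chain complex
   of a full simplex, hence G resolves R / I_L. Tensoring with k kills the faces
   x^m T with m <> 0, which are the nonempty faces of the gcd complex. So the
   degree b part of k (x) G is the relative chain complex of the pair (full simplex
   on C_b, gcd complex), whose long exact sequence yields
   Tor_i(R / I_L, k)_b = H~_{i-1}(gcd complex). By the comparison theorem every
   graded free resolution gives the same Tor. *)
Require Import Defs.
From HB Require Import structures.
From mathcomp Require Import all_boot all_order all_algebra.
From mathcomp Require Import finmap freeg mpoly boolp.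

Set Implicit Arguments.
Unset Strict Implicit.
Unset Printing Implicit Defensive.

Import Order.TTheory GRing.Theory.
Import Quotient.

Local Open Scope ring_scope.

(** * Free modules on a set and dimensions of quotients *)

(** The cone that contracts a full simplex needs a chosen monomial in each fiber, and these choices
    are not compatible with multiplication by monomials. The contraction is therefore only
    [k]-linear: exactness is proved on [k]-chains of finite sets and carried to the free [R]-modules
    by the bijections [to_free] and [of_free]. The empty face is absent from G, so its left-over end
    is treated separately: R / I_L takes its place, and exactness there says that the binomials of
    edges span I_L. The comparison of resolutions must respect degrees, while exactness of a
    resolution is stated without degrees; projections to homogeneous parts bridge the gap. G may
    have infinite rank, so no dimension is counted on the Tor side. The number [d] comes from the
    simplicial side, where fibers are finite by Dickson's lemma, and is carried over by explicit
    maps inducing isomorphisms. *)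

Section FreegSum.
Context (R : nzRingType) (K : choiceType).

Lemma freeg_ind_dom (D : K -> Prop) (P : {freeg K / R} -> Prop) :
    P 0 -> (forall x y, P x -> P y -> P (x + y)) ->
    (forall c e, D e -> P << c *g e >>) ->
  forall x, (forall e, e \in dom x -> D e) -> P x.
Proof.
move=> P0 PD PU x xD; rewrite -(freeg_sumE x) big_seq.
by elim/big_rec: _ => // e y /xD De Py; apply: PD => //; apply: PU.
Qed.

Lemma freeg_ind_add (P : {freeg K / R} -> Prop) :
    P 0 -> (forall x y, P x -> P y -> P (x + y)) ->
    (forall c e, P << c *g e >>) -> forall x, P x.
Proof.
move=> P0 PD PU x; apply: (@freeg_ind_dom (fun=> True)) => // c e _; exact: PU.
Qed.

Lemma freegUZ (c : R) (e : K) : << c *g e >> = c *: << e >> :> {freeg K / R}.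
Proof. by apply/eqP/freeg_eqP => z; rewrite coeffZ !coeffU mul1r. Qed.

(** Unlike [fglift], this allows [h e] to be merely additive in the coefficient; evaluation at the
    origin, homogeneous parts and the passage between chains and free modules are all of this
    kind. *)
Definition fgsum (V : zmodType) (h : K -> R -> V) (x : {freeg K / R}) : V :=
  \sum_(e <- dom x) h e (coeff e x).

Section Additive.
Context (V : zmodType) (h : K -> R -> V).
Hypothesis hD : forall e, {morph h e : a b / a + b}.

(** An additive [h e] vanishes at 0, so indices outside the support are harmless; this gives
    elements with different supports a common index sequence. *)
Lemma fgsum_widen (s : seq K) x : uniq s -> {subset dom x <= s} ->
  fgsum h x = \sum_(e <- s) h e (coeff e x).
Proof.
have h0 e : h e 0 = 0.
  by apply: (addrI (h e 0)); rewrite -hD !addr0.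
move=> us sub; rewrite [RHS](bigID (fun e => e \in dom x)) /= [X in _ + X]big1.
  rewrite addr0 -[RHS]big_filter; apply: perm_big; apply: uniq_perm.
  - exact: uniq_dom.
  - exact: filter_uniq.
  move=> e; rewrite mem_filter; case: (boolP (e \in dom x)) => //= /sub -> //.
by move=> e /coeff_outdom ->.
Qed.

Lemma fgsumD : {morph fgsum h : x y / x + y}.
Proof.
move=> x y; pose s := undup (dom x ++ dom y).
have us : uniq s by exact: undup_uniq.
rewrite !(fgsum_widen us) -?big_split /=.
- by apply: eq_bigr => e _; rewrite coeffD hD.
- by move=> e; rewrite mem_undup mem_cat => ->; rewrite orbT.
- by move=> e; rewrite mem_undup mem_cat => ->.
- by move=> e; rewrite mem_undup => /domD_subset.
Qed.

Lemma fgsumU c e : fgsum h << c *g e >> = h e c.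
Proof.
rewrite (@fgsum_widen [:: e]) ?big_seq1 ?coeffU ?eqxx ?mulr1 //.
by move=> z; rewrite mem_dom coeffU inE; case: (eqVneq e z) => //;
  rewrite mulr0 eqxx.
Qed.

Lemma fgsumB : {morph fgsum h : x y / x - y}.
Proof.
move=> x y; apply: (addIr (fgsum h y)).
by rewrite -fgsumD !addrNK.
Qed.

End Additive.

Context (V : lmodType R).

Lemma fglift_sum (f : K -> V) x :
  fglift f x = \sum_(e <- dom x) coeff e x *: f e.
Proof.
pose h e (c : R) := c *: f e.
have hD e : {morph h e : a b / a + b} by move=> a b; rewrite /h scalerDl.
have liftD : {morph fglift f : x y / x + y}.
  (* [lift_is_additive] speaks of differences, hence the detour through a double subtraction. *)
  move=> u v; have lB := lift_is_additive f.
  have -> : u + v = u - (0 - v) by rewrite sub0r opprK.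
  by rewrite !lB -(subrr v) lB subrr sub0r opprK.
rewrite -[RHS]/(fgsum h x); elim/freeg_ind_add: x.
- rewrite /fgsum dom0 big_nil.
  by apply: (addrI (fglift f 0)); rewrite -liftD !addr0.
- by move=> u v; rewrite liftD fgsumD // => -> ->.
- by move=> c e; rewrite liftU fgsumU.
Qed.

Lemma fglift_linear (f : K -> V) : linear (fglift f).
Proof.
move=> a x y; pose h e (c : R) := c *: f e.
have hD e : {morph h e : a b / a + b} by move=> b c; rewrite /h scalerDl.
have E u : fglift f u = fgsum h u by rewrite fglift_sum.
rewrite !E fgsumD //; congr (_ + _); rewrite -!E; elim/freeg_ind_add: x.
- by rewrite scaler0 E /fgsum dom0 big_nil scaler0.
- by move=> u v; rewrite !E scalerDr !fgsumD // scalerDr => -> ->.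
- by move=> c e; rewrite (freegUZ c) scalerA -!freegUZ !liftU scalerA.
Qed.

HB.instance Definition _ (f : K -> V) :=
  GRing.isLinear.Build R {freeg K / R} V _ (fglift f) (fglift_linear f).

Lemma fgliftU1 (f : K -> V) e : fglift f << e >> = f e.
Proof. by rewrite liftU scale1r. Qed.

Lemma linear_freegE (f : {linear {freeg K / R} -> V}) x :
  f x = \sum_(e <- dom x) coeff e x *: f << e >>.
Proof.
rewrite -{1}(freeg_sumE x) raddf_sum /=.
by apply: eq_bigr => e _; rewrite freegUZ linearZ.
Qed.

Lemma linear_freeg_eq_dom (f g : {linear {freeg K / R} -> V}) x :
  (forall e, e \in dom x -> f << e >> = g << e >>) -> f x = g x.
Proof.
move=> fg; rewrite !linear_freegE big_seq [RHS]big_seq.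
by apply: eq_bigr => e /fg ->.
Qed.

Lemma linear_freeg_eq (f g : {linear {freeg K / R} -> V}) :
  (forall e, f << e >> = g << e >>) -> f =1 g.
Proof. by move=> fg x; apply: linear_freeg_eq_dom => e _. Qed.

End FreegSum.

(** Degree, cardinality and fiber conditions on chains are all conditions on the support, so
    checking them on generators suffices. *)
Lemma dom_fglift_sub (R : nzRingType) (K K' : choiceType)
    (f : K -> {freeg K' / R}) (D : K -> Prop) (D' : K' -> Prop) x :
    (forall e, D e -> forall e', e' \in dom (f e) -> D' e') ->
    (forall e, e \in dom x -> D e) ->
  forall e', e' \in dom (fglift f x) -> D' e'.
Proof.
move=> fD xD e'; rewrite fglift_sum => /dom_sum_subset /flattenP[s].
case/mapP => e; rewrite mem_filter /= => ex ->.
by move/domZ_subset; apply: fD; apply: xD.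
Qed.

Lemma dom_freegU_sub (R : nzRingType) (K : choiceType) (c : R) (e e' : K) :
  e' \in dom << c *g e >> -> e' = e.
Proof. by rewrite mem_dom coeffU; case: (eqVneq e e') => //;
  rewrite mulr0 eqxx. Qed.

Lemma dom_linearP (R : nzRingType) (K : choiceType) (D : K -> Prop)
    (a : R) (x y : {freeg K / R}) :
    (forall e, e \in dom x -> D e) -> (forall e, e \in dom y -> D e) ->
  forall e, e \in dom (a *: x + y) -> D e.
Proof.
move=> xD yD e /domD_subset; rewrite mem_cat => /orP[/domZ_subset/xD|/yD] //.
Qed.

(** * Dimensions of quotients of subspaces given by predicates *)

Section QuotientDimension.
Context (k : fieldType).

Definition subspace (V : lmodType k) (Z : V -> Prop) :=
  Z 0 /\ forall a u v, Z u -> Z v -> Z (a *: u + v).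

Lemma subspace_sum (V : lmodType k) (Z : V -> Prop) d (c : 'I_d -> k)
    (e : 'I_d -> V) :
  subspace Z -> (forall j, Z (e j)) -> Z (\sum_j c j *: e j).
Proof. by case=> Z0 ZD Ze; elim/big_rec: _ => // j x _; apply: ZD. Qed.

Lemma subspaceD (V : lmodType k) (Z : V -> Prop) u v :
  subspace Z -> Z u -> Z v -> Z (u + v).
Proof. by case=> _ ZD Zu Zv; rewrite -(scale1r u); apply: ZD. Qed.

Lemma subspaceZ (V : lmodType k) (Z : V -> Prop) a u :
  subspace Z -> Z u -> Z (a *: u).
Proof. by case=> Z0 ZD Zu; rewrite -[_ *: _]addr0; apply: ZD. Qed.

Lemma subspaceB (V : lmodType k) (Z : V -> Prop) u v :
  subspace Z -> Z u -> Z v -> Z (u - v).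
Proof.
by move=> sZ Zu Zv; rewrite -scaleN1r addrC; case: sZ => _; apply.
Qed.

(** The hypotheses make [f] induce an isomorphism from Z / B to Z' / B': the equivalence gives
    well-definedness and injectivity, the last one surjectivity. Hence [f] carries a basis to a
    basis. *)
Lemma has_dim_quotient_iso (V W : lmodType k) (f : {linear V -> W})
    (Z B : V -> Prop) (Z' B' : W -> Prop) d :
    subspace Z -> subspace B' ->
    (forall z, Z z -> Z' (f z)) ->
    (forall z, Z z -> B z <-> B' (f z)) ->
    (forall w, Z' w -> exists2 z, Z z & B' (w - f z)) ->
  has_dim_quotient Z B d -> has_dim_quotient Z' B' d.
Proof.
move=> sZ sB' fZ fB fsurj [e [Ze span indep]]; exists (f \o e).
have fE c : \sum_j c j *: (f \o e) j = f (\sum_j c j *: e j).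
  by rewrite raddf_sum /=; apply: eq_bigr => j _; rewrite linearZ.
split=> [j|w /fsurj[z Zz wz]|c].
- exact: fZ.
- have [c zc] := span z Zz; exists c; rewrite fE.
  have -> : w - f (\sum_j c j *: e j)
            = (w - f z) + f (z - \sum_j c j *: e j).
    by rewrite linearB /= addrA subrK.
  apply: subspaceD => //; apply/fB => //; apply: subspaceB => //.
  exact: subspace_sum.
- by rewrite fE => /fB H; apply: indep; apply: H; apply: subspace_sum.
Qed.

(** A family in [Z] that is independent modulo [B] has at most [N] members; one of maximal length
    spans, since otherwise it could be extended. *)
Lemma has_dim_quotient_exists (V : lmodType k) (Z B : V -> Prop) N
    (g : 'I_N -> V) :
    subspace Z -> subspace B ->
    (forall z, Z z -> exists c : 'I_N -> k, z = \sum_i c i *: g i) ->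
  exists d, has_dim_quotient Z B d.
Proof.
move=> sZ sB Zg.
pose P d := exists e : 'I_d -> V, (forall j, Z (e j)) /\
  forall c : 'I_d -> k, B (\sum_j c j *: e j) -> forall j, c j = 0.
have P_le d : P d -> (d <= N)%N.
  case=> e [Ze indep]; rewrite leqNgt; apply/negP => ltNd.
  have /choice[a ea] j : exists a : 'I_N -> k, e j = \sum_i a i *: g i.
    exact/Zg/Ze.
  pose A : 'M[k]_(d, N) := \matrix_(j, i) a j i.
  (* [A] has more rows than columns; a nonzero row of its left kernel is a linear relation among the
     [e j]. *)
  have /rowV0Pn[c /sub_kermxP cA c0] : kermx A != 0.
    by rewrite kermx_eq0 /row_free neq_ltn (leq_ltn_trans (rank_leq_col A)).
  case/negP: c0; apply/eqP/rowP => j; rewrite mxE.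
  apply: (indep (fun j => c 0 j)).
  suff -> : \sum_j c 0 j *: e j = 0 by case: sB.
  under eq_bigr => l _ do rewrite ea scaler_sumr.
  rewrite exchange_big big1 //= => i _.
  under eq_bigr => l _ do rewrite scalerA.
  have cA0 : \sum_l c 0 l * a l i = 0.
    have /matrixP/(_ 0 i) := cA; rewrite !mxE; apply: etrans.
    by apply: eq_bigr => l _; rewrite mxE.
  by rewrite -scaler_suml cA0 scale0r.
have exP : exists d, `[< P d >].
  exists 0%N; apply/asboolP; exists (fun=> 0); by split=> [[]|c _ []].
have ub d : `[< P d >] -> (d <= N)%N by move/asboolP/P_le.
case: (ex_maxnP exP ub) => d /asboolP[e [Ze indep]] dmax; exists d, e.
split=> // z Zz; apply: contrapT => nspan.
suff /asboolP/dmax : P d.+1 by rewrite ltnn.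
(* The unspanned vector [z] is appended in the last position. *)
exists (fun j => if unlift ord_max j is Some j' then e j' else z); split.
  by move=> j; case: unliftP.
move=> c; rewrite big_ord_recr /= unlift_none.
have -> : \sum_(i < d) c (widen_ord (leqnSn d) i) *:
    (if unlift ord_max (widen_ord (leqnSn d) i) is Some j' then e j' else z)
  = \sum_(i < d) c (fintype.lift ord_max i) *: e i.
  apply: eq_bigr => i _.
  have -> : widen_ord (leqnSn d) i = fintype.lift ord_max i.
    by apply: val_inj; rewrite /= /bump leqNgt ltn_ord.
  by rewrite liftK.
have [c0|c0] := eqVneq (c ord_max) 0.
  rewrite c0 scale0r addr0 => /indep cl j.
  by case: (unliftP ord_max j) => [j'|] ->.
(* Dividing by the nonzero coefficient of [z] expresses [z] through the [e i] modulo [B], a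
   contradiction. *)
move=> Bc; case: nspan;
  exists (fun i => - (c ord_max)^-1 * c (fintype.lift ord_max i)).
have := subspaceZ (c ord_max)^-1 sB Bc.
rewrite scalerDr scalerA mulVf // scale1r scaler_sumr addrC -sumrN.
congr (B (_ + _)); apply: eq_bigr => i _.
by rewrite scalerA mulNr scaleNr opprK.
Qed.

End QuotientDimension.

(** * Graded free modules over the polynomial ring *)

Section GradedFreeModules.
Context (k : fieldType) (n : nat) (L : zmodClosed 'rV[int]_n).
Local Notation R := {mpoly k[n]}.
Implicit Types (b : {quot L}) (m : 'X_{1..n}).

Lemma degAD m1 m2 : degA L (m1 + m2)%MM = degA L m1 + degA L m2.
Proof.
by rewrite /degA -big_split; apply: eq_bigr => i _; rewrite mnmDE mulrnDr.
Qed.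

Lemma degA0 : degA L 0%MM = 0.
Proof. by rewrite /degA big1 // => i _; rewrite mnm0E mulr0n. Qed.

Lemma degAE m : degA L m = \pi_{quot L}%qT (exponent m).
Proof.
rewrite /degA (eq_bigr (fun i => \pi_{quot L}%qT (delta_mx 0 i *+ m i))).
  rewrite -raddf_sum /=; congr (\pi_{quot L}%qT _).
  apply/rowP => j; rewrite summxE mxE (bigD1 j) //= big1 ?addr0.
    by rewrite mulmxnE mxE !eqxx mulr1n natz.
  by move=> i /negPf ij; rewrite mulmxnE mxE eqxx eq_sym ij mul0rn.
by move=> i _; rewrite raddfMn.
Qed.

Lemma degA_eq u v : degA L u = degA L v <-> exponent u - exponent v \in L.
Proof.
by rewrite !degAE Quotient.idealrBE; split=> [/eqP|/eqP].
Qed.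

Section Terms.
Context (B : choiceType).
Implicit Types (e : B) (x y : {freeg B / R}).

(** The last premise has the shape of [free_homog], so induction on a homogeneous element meets only
    terms of the right degree. *)
Lemma freeg_term_ind (D : B -> 'X_{1..n} -> Prop) (P : {freeg B / R} -> Prop) :
    P 0 -> (forall x y, P x -> P y -> P (x + y)) ->
    (forall c m e, D e m -> P ((c *: 'X_[m]) *: << e >>)) ->
  forall x, (forall e m, m \in msupp (coeff e x) -> D e m) -> P x.
Proof.
move=> P0 PD PT x xD; rewrite -(freeg_sumE x).
elim/big_rec: _ => // e y _ Py; apply: (PD) => //.
rewrite freegUZ [X in X *: _]mpolyE scaler_suml big_seq.
by elim/big_rec: _ => // m z /xD eD Pz; apply: PD => //; apply: PT.
Qed.

Lemma freeg_mpoly_ind (P : {freeg B / R} -> Prop) :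
    P 0 -> (forall x y, P x -> P y -> P (x + y)) ->
    (forall c m e, P ((c *: 'X_[m]) *: << e >>)) -> forall x, P x.
Proof.
by move=> P0 PD PT x; apply: (@freeg_term_ind (fun _ _ => True)) => // *;
  apply: PT.
Qed.

Definition fgterms (V : zmodType) (h : B -> 'X_{1..n} -> k -> V) x : V :=
  fgsum (fun e (p : R) => fgsum (h e) (mpoly_val p)) x.

Section Additive.
Context (V : zmodType) (h : B -> 'X_{1..n} -> k -> V).
Hypothesis hD : forall e m, {morph h e m : a c / a + c}.

Let hD1 e : {morph (fun p : R => fgsum (h e) (mpoly_val p)) : p q / p + q}.
Proof. by move=> p q; rewrite -fgsumD. Qed.

Lemma fgtermsD : {morph fgterms h : x y / x + y}.
Proof. exact: fgsumD. Qed.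

Lemma fgterms0 : fgterms h 0 = 0.
Proof. by rewrite /fgterms /fgsum dom0 big_nil. Qed.

Lemma fgtermsU c m e : fgterms h ((c *: 'X_[m]) *: << e >>) = h e m c.
Proof.
rewrite -freegUZ /fgterms fgsumU // -MPolyU.
exact: fgsumU.
Qed.

End Additive.

Context (deg : B -> {quot L}).

Lemma free_homog0 b : free_homog deg b (0 : {freeg B / R}).
Proof. by move=> e m; rewrite coeff0 msupp0. Qed.

Lemma free_homogD b x y :
  free_homog deg b x -> free_homog deg b y -> free_homog deg b (x + y).
Proof.
move=> hx hy e m; rewrite coeffD => /msuppD_le.
by rewrite mem_cat => /orP[/hx|/hy].
Qed.

Lemma free_homogN b x : free_homog deg b x -> free_homog deg b (- x).
Proof. by move=> hx e m; rewrite coeffN (perm_mem (msuppN _)) => /hx. Qed.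

Lemma free_homogB b x y :
  free_homog deg b x -> free_homog deg b y -> free_homog deg b (x - y).
Proof. by move=> hx /free_homogN; apply: free_homogD. Qed.

Lemma free_homogZ c b (p : R) x :
    poly_homog c p -> free_homog deg b x ->
  free_homog deg (c + b) (p *: x).
Proof.
move=> hp hx e m; rewrite coeffZ =>
  /msuppM_le /allpairsP[[m1 m2] /= [m1p m2x ->]].
by rewrite degAD -addrA (hp _ m1p) (hx _ _ m2x).
Qed.

Lemma free_homogU e : free_homog deg (deg e) (<< e >> : {freeg B / R}).
Proof.
move=> e' m; rewrite coeffU mul1r; case: (eqVneq e e') => [->|_].
  by rewrite msupp1 inE => /eqP ->; rewrite degA0 add0r.
by rewrite msupp0.
Qed.

Lemma poly_homogX c m : poly_homog (degA L m) (c *: 'X_[m] : R).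
Proof. by move=> m' /msuppZ_le; rewrite msuppX inE => /eqP ->. Qed.

Lemma free_homog_term c m e :
  free_homog deg (degA L m + deg e) ((c *: 'X_[m] : R) *: << e >>).
Proof. by apply: free_homogZ; [exact: poly_homogX|exact: free_homogU]. Qed.

Definition homog_part b : {freeg B / R} -> {freeg B / R} :=
  fgterms (fun e m c =>
    if degA L m + deg e == b then (c *: 'X_[m]) *: << e >> else 0).

Let partD b e m : {morph (fun c =>
  if degA L m + deg e == b then (c *: 'X_[m]) *: << e >> else 0 : {freeg B / R})
  : a c / a + c}.
Proof.
by move=> a c; case: ifP => _; rewrite ?addr0 // !scalerDl.
Qed.

Lemma homog_partD b : {morph homog_part b : x y / x + y}.
Proof. by apply: fgtermsD; exact: partD. Qed.

Lemma homog_part0 b : homog_part b 0 = 0.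
Proof. exact: fgterms0. Qed.

Lemma homog_part_term b c m e : homog_part b ((c *: 'X_[m]) *: << e >>) =
  if degA L m + deg e == b then (c *: 'X_[m]) *: << e >> else 0.
Proof. by rewrite /homog_part fgtermsU //; exact: partD. Qed.

Lemma homog_partE c b x :
  free_homog deg c x -> homog_part b x = if c == b then x else 0.
Proof.
move=> hx; elim/freeg_term_ind: x / hx.
- by rewrite homog_part0 if_same.
- by move=> x y; rewrite homog_partD => -> ->; case: ifP; rewrite ?addr0.
- by move=> a m e <-; rewrite homog_part_term.
Qed.

Lemma homog_part_homog b x : free_homog deg b (homog_part b x).
Proof.
elim/freeg_mpoly_ind: x.
- by rewrite homog_part0; exact: free_homog0.
- by move=> x y; rewrite homog_partD; exact: free_homogD.
- move=> c m e; rewrite homog_part_term; case: eqP => [<-|_].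
    exact: free_homog_term.
  exact: free_homog0.
Qed.

End Terms.

Section HomogeneousMaps.
Context (B C : choiceType) (degB : B -> {quot L}) (degC : C -> {quot L}).
Implicit Types f : {linear {freeg B / R} -> {freeg C / R}}.

Lemma linear_homog f :
    (forall e, free_homog degC (degB e) (f << e >>)) ->
  forall b x, free_homog degB b x -> free_homog degC b (f x).
Proof.
move=> hf b x hx; elim/freeg_term_ind: x / hx.
- by rewrite linear0; exact: free_homog0.
- by move=> x y; rewrite linearD; exact: free_homogD.
- move=> c m e <-; rewrite linearZ /=; apply: free_homogZ => //.
  exact: poly_homogX.
Qed.

(** This turns an arbitrary preimage of a homogeneous element into a homogeneous one. *)
Lemma linear_homog_part f :
    (forall b x, free_homog degB b x -> free_homog degC b (f x)) ->
  forall b x, f (homog_part degB b x) = homog_part degC b (f x).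
Proof.
move=> hf b x; elim/freeg_mpoly_ind: x.
- by rewrite !(homog_part0, linear0).
- by move=> x y; rewrite homog_partD !linearD homog_partD => -> ->.
- move=> c m e; rewrite homog_part_term.
  have /hf/homog_partE -> : free_homog degB (degA L m + degB e)
      ((c *: 'X_[m] : R) *: << e >>) by exact: free_homog_term.
  by case: ifP; rewrite ?linear0.
Qed.

End HomogeneousMaps.
End GradedFreeModules.

Arguments free_homogU {k n L B} deg e.
Arguments free_homog_term {k n L B} deg c m e.

(** * Reduction modulo the irrelevant ideal *)

(** Dependent choice with a type varying along the sequence: chain maps and homotopies are built
    degree by degree, [P] being the invariant that makes the next step possible and [Q] the equation
    linking neighbours. *)
Lemma dependent_sequence (T : nat -> Type) (P : forall i, T i -> Prop)
    (Q : forall i, T i -> T i.+1 -> Prop) (t0 : T 0%N) :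
    P 0%N t0 ->
    (forall i t, P i t -> exists2 t', P i.+1 t' & Q i t t') ->
  exists2 f : forall i, T i,
    f 0%N = t0 & forall i, P i (f i) /\ Q i (f i) (f i.+1).
Proof.
move=> P0 step.
have next i (t : {t : T i | P i t}) :
    {t' : {t' : T i.+1 | P i.+1 t'} | Q i (proj1_sig t) (proj1_sig t')}.
  apply: cid; case: t => t Pt /=; have [t' Pt' Qt'] := step i t Pt.
  by exists (exist _ t' Pt').
pose f := fix f i : {t : T i | P i t} := match i with
  | 0 => exist _ t0 P0
  | j.+1 => proj1_sig (next j (f j))
  end.
exists (fun i => proj1_sig (f i)) => // i; split; first exact: proj2_sig.
exact: (proj2_sig (next i (f i))).
Qed.

Section Tensor.
Context (k : fieldType) (n : nat).
Local Notation R := {mpoly k[n]}.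

Lemma meval_at0 (p : R) : p.@[fun=> 0] = p@_0%MM.
Proof.
elim/mpolyind: p => [|c m p _ _ IH]; first by rewrite meval0 mcoeff0.
rewrite mevalD mcoeffD IH mevalZ mcoeffZ mcoeffX mevalX; congr (_ * _ + _).
have [->|m0] := eqVneq m 0%MM.
  by rewrite big1 // => i _; rewrite mnm0E expr0.
have [i mi] : exists i, m i != 0%N.
  apply: contrapT => H; case/negP: m0; apply/eqP/mnmP => i; rewrite mnm0E.
  by apply/eqP/negPn/negP => mi; apply: H; exists i.
by rewrite (bigD1 i) //= expr0n (negPf mi) mul0r.
Qed.

Section ReduceMod.
Context (B : choiceType).
Implicit Types (x y : {freeg B / R}).

Let termD (e : B) :
  {morph (fun p : R => << p.@[fun=> 0] *g e >> : {freeg B / k})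
    : p q / p + q}.
Proof. by move=> p q; rewrite mevalD -freegUD. Qed.

Lemma reduce_modD : {morph @reduce_mod k n B : x y / x + y}.
Proof. exact: (fgsumD termD). Qed.

Lemma reduce_modUZ (p : R) (e : B) :
  reduce_mod << p *g e >> = << p.@[fun=> 0] *g e >>.
Proof. exact: (fgsumU termD). Qed.

Lemma reduce_mod0 : reduce_mod (0 : {freeg B / R}) = 0.
Proof. by rewrite /reduce_mod dom0 big_nil. Qed.

Lemma reduce_modZ (p : R) x :
  reduce_mod (p *: x) = p.@[fun=> 0] *: reduce_mod x.
Proof.
elim/freeg_ind_add: x => [|x y|q e].
- by rewrite !(scaler0, reduce_mod0).
- by rewrite scalerDr !reduce_modD scalerDr => -> ->.
- rewrite (freegUZ q) scalerA -!freegUZ.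
  by rewrite !reduce_modUZ mevalM freegUZ -scalerA -freegUZ.
Qed.

Lemma reduce_modU (e : B) : reduce_mod (<< e >> : {freeg B / R}) = << e >>.
Proof. by rewrite reduce_modUZ meval1. Qed.

Lemma coeff_reduce_mod (e : B) x :
  coeff e (reduce_mod x) = (coeff e x)@_0%MM.
Proof.
elim/freeg_ind_add: x => [|x y|p e'].
- by rewrite reduce_mod0 !coeff0 mcoeff0.
- by rewrite reduce_modD !coeffD mcoeffD => -> ->.
rewrite reduce_modUZ !coeffU; case: eqP => _; rewrite ?mulr0 ?mcoeff0 // !mulr1.
exact: meval_at0.
Qed.

End ReduceMod.

Section TensorK.
Context (B C : choiceType).
Implicit Types (f : {linear {freeg B / R} -> {freeg C / R}}).

(** Naturality of the passage from F to F tensor k; functoriality of [tensor_k] rests on it. *)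
Lemma reduce_mod_linear f x : reduce_mod (f x) = tensor_k f (reduce_mod x).
Proof.
elim/freeg_ind_add: x => [|x y|p e].
- by rewrite linear0 !reduce_mod0 /tensor_k linear0.
- by rewrite linearD !reduce_modD /tensor_k linearD /= => -> ->.
- rewrite freegUZ linearZ /= !reduce_modZ reduce_modU.
  by rewrite [in RHS]/tensor_k linearZ /= fgliftU1.
Qed.

Lemma eq_tensor_k (f g : {freeg B / R} -> {freeg C / R}) :
  f =1 g -> tensor_k f =1 tensor_k g.
Proof.
move=> fg z; rewrite /tensor_k; apply: linear_freeg_eq => e.
by rewrite /= !fgliftU1 fg.
Qed.

Lemma tensor_kD (f g : {freeg B / R} -> {freeg C / R}) z :
  tensor_k (f \+ g) z = tensor_k f z + tensor_k g z.
Proof.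
rewrite /tensor_k; elim/freeg_ind_add: z => [|x y|c e].
- by rewrite !linear0 addr0.
- by rewrite !linearD /= => -> ->; rewrite addrACA.
- by rewrite freegUZ !linearZ /= !fgliftU1 reduce_modD scalerDr.
Qed.

End TensorK.

Lemma tensor_k_comp (B C D : choiceType)
    (f : {linear {freeg B / R} -> {freeg C / R}})
    (g : {linear {freeg C / R} -> {freeg D / R}}) z :
  tensor_k (g \o f) z = tensor_k g (tensor_k f z).
Proof.
pose h := [the {linear _ -> _} of fglift (fun e => reduce_mod (g << e >>))
  \o fglift (fun e => reduce_mod (f << e >>))].
rewrite -[RHS]/(h z) /tensor_k; apply: linear_freeg_eq => e.
by rewrite /h /= !fgliftU1 (reduce_mod_linear g).
Qed.

Lemma tensor_k_id (B : choiceType) z :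
  tensor_k (idfun : {freeg B / R} -> _) z = z.
Proof.
rewrite /tensor_k; elim/freeg_ind_add: z => [|x y|c e].
- by rewrite linear0.
- by rewrite linearD /= => -> ->.
- by rewrite freegUZ linearZ /= fgliftU1 reduce_modU.
Qed.

End Tensor.

(** * Comparison of graded free resolutions *)

Section Comparison.
Context (k : fieldType) (n : nat) (L : zmodClosed 'rV[int]_n).
Local Notation R := {mpoly k[n]}.
Context (M : lmodType R) (gr : {quot L} -> M -> Prop).
Implicit Types (F G : graded_free_resolution gr) (b : {quot L}).

(* The augmentation is put in degree 0, so that M and the free modules are
   treated uniformly. *)
Definition aug_mod F i : lmodType R :=
  match i with 0 => M | j.+1 => {freeg (Defs.basis F j) / R} : lmodType R end.

Definition aug_diff F i : {linear aug_mod F i.+1 -> aug_mod F i} :=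
  match i with 0 => augm F | j.+1 => diff F j end.

Definition aug_homog F i : {quot L} -> aug_mod F i -> Prop :=
  match i with 0 => gr | j.+1 => free_homog (bdeg (g := F) (i := j)) end.

Definition aug_cycle F i : aug_mod F i -> Prop :=
  match i with 0 => fun=> True | j.+1 => fun x => aug_diff F j x = 0 end.

Lemma aug_cycle_diff F i x : aug_cycle (aug_diff F i x).
Proof.
by case: i x => [|[|i]] x //=; [apply/augm_exact|apply/diff_exact]; exists x.
Qed.

Lemma aug_homog_diff F i b x : aug_homog b x -> aug_homog b (aug_diff F i x).
Proof. by case: i x => [|i] x; [exact: augm_homog|exact: diff_homog]. Qed.

(* Graded surjectivity of the augmentation; it does not follow from [augm_surj]
   unless M is the direct sum of its graded parts. *)
Hypothesis augm_cover : forall F b y, gr b y ->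
  exists2 x, free_homog (bdeg (g := F) (i := 0)) b x & augm F x = y.

(** Exactness supplies some preimage; its degree [b] part is still one because the differential
    commutes with homogeneous parts. At M itself the hypothesis [augm_cover] takes over. *)
Lemma aug_homog_exact F i b (y : aug_mod F i) : aug_homog b y -> aug_cycle y ->
  exists2 x, aug_homog b x & aug_diff F i x = y.
Proof.
have lift j (z : {freeg (Defs.basis F j) / R}) x :
    free_homog (bdeg (g := F) (i := j)) b z -> z = diff F j x ->
    exists2 x', free_homog (bdeg (g := F) (i := j.+1)) b x' & diff F j x' = z.
  move=> hz zx; exists (homog_part (bdeg (g := F) (i := j.+1)) b x).
    exact: homog_part_homog.
  rewrite (linear_homog_part (degC := bdeg (g := F) (i := j))).
    by rewrite -zx (homog_partE b hz) eqxx.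
  by move=> c z'; apply: diff_homog.
case: i y => [|[|i]] y /= hy; first by move=> _; apply: augm_cover.
  by move=> /augm_exact[x /lift]; apply.
by move=> /diff_exact[x /lift]; apply.
Qed.

(** Projectivity of free modules: homogeneous preimages are chosen for the images of the basis
    elements. *)
Lemma graded_lift (B : choiceType) (deg : B -> {quot L}) F i
    (a : {linear {freeg B / R} -> aug_mod F i}) :
    (forall e, aug_homog (deg e) (a << e >>)) ->
    (forall e, aug_cycle (a << e >>)) ->
  exists2 f : {linear {freeg B / R} -> aug_mod F i.+1},
    forall b x, free_homog deg b x -> aug_homog b (f x)
    & forall x, aug_diff F i (f x) = a x.
Proof.
move=> ha ca.
have /choice[g gP] : forall e, exists y : {freeg (Defs.basis F i) / R},
    free_homog (bdeg (g := F) (i := i)) (deg e) y /\ aug_diff F i y = a << e >>.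
  by move=> e; have [y hy yE] := aug_homog_exact (ha e) (ca e); exists y.
exists (fglift g : {linear {freeg B / R} -> {freeg (Defs.basis F i) / R}}).
  move=> b x; apply: (linear_homog (f := fglift g)) => e; rewrite /= fgliftU1.
  by case: (gP e).
move=> x; pose h := [the {linear {freeg B / R} -> aug_mod F i} of
  aug_diff F i \o fglift g].
rewrite -[LHS]/(h x); apply: linear_freeg_eq => e.
by rewrite /h /= fgliftU1; case: (gP e).
Qed.

Lemma comparison_map F G :
  exists f : forall i, {linear aug_mod F i -> aug_mod G i},
  [/\ forall x, f 0%N x = x,
      forall i b x, aug_homog b x -> aug_homog b (f i x)
    & forall i x, aug_diff G i (f i.+1 x) = f i (aug_diff F i x)].
Proof.
pose T i := {linear aug_mod F i -> aug_mod G i}.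
(* Preservation of cycles is the invariant: it puts the image of [f \o aug_diff F i] among the
   cycles, where [graded_lift] applies. *)
pose P i (f : T i) := (forall b x, aug_homog b x -> aug_homog b (f x)) /\
  (forall x, aug_cycle x -> aug_cycle (f x)).
pose Q i (f : T i) (f' : T i.+1) :=
  forall x, aug_diff G i (f' x) = f (aug_diff F i x).
have [||f f0 fPQ] := @dependent_sequence T P Q (idfun : {linear M -> M}).
- by split.
- move=> i f [fh fc].
  have [||g gh gd] := @graded_lift _ (bdeg (g := F) (i := i)) G i
      [the {linear _ -> _} of f \o aug_diff F i].
  + by move=> e; apply/fh/aug_homog_diff/free_homogU.
  + by move=> e; apply/fc/aug_cycle_diff.
  exists g => //; split=> // x; rewrite /= => dx.
  by rewrite gd /= dx linear0.
exists f; split=> [x|i|i x].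
- by rewrite f0.
- by case: (fPQ i) => -[].
- by case: (fPQ i) => _; apply.
Qed.

Lemma null_homotopy F (f : forall i, {linear aug_mod F i -> aug_mod F i}) :
    (forall x, f 0%N x = 0) ->
    (forall i b (x : aug_mod F i.+1),
      aug_homog b x -> aug_homog b (f i.+1 x)) ->
    (forall i x, aug_diff F i (f i.+1 x) = f i (aug_diff F i x)) ->
  exists h : forall i, {linear aug_mod F i -> aug_mod F i.+1},
  [/\ forall x, h 0%N x = 0,
      forall i b x, aug_homog b x -> aug_homog b (h i x)
    & forall i x, f i.+1 x = aug_diff F i.+1 (h i.+1 x) + h i (aug_diff F i x)].
Proof.
move=> f0 fh fd.
pose T i := {linear aug_mod F i -> aug_mod F i.+1}.
(* The map f - h d takes values in cycles, so it can be lifted to give the next [h]. *)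
pose P i (h : T i) := (forall b x, aug_homog b x -> aug_homog b (h x)) /\
  (forall x, aug_diff F i (f i.+1 x - h (aug_diff F i x)) = 0).
pose Q i (h : T i) (h' : T i.+1) :=
  forall x, f i.+1 x = aug_diff F i.+1 (h' x) + h (aug_diff F i x).
have [||h h0 hPQ] := @dependent_sequence T P Q
  (\0 : {linear M -> {freeg (Defs.basis F 0) / R}}).
- split=> [b x _|x]; first exact: free_homog0.
  by rewrite subr0 fd f0.
- move=> i h [hh hc].
  have [||g gh gd] := @graded_lift _ (bdeg (g := F) (i := i)) F i.+1
      [the {linear _ -> _} of f i.+1 \-
        ((h : {linear aug_mod F i -> aug_mod F i.+1}) \o aug_diff F i)].
  + move=> e; apply: free_homogB; first exact: (fh i _ _ (free_homogU _ e)).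
    exact/hh/(aug_homog_diff (i := i))/free_homogU.
  + by move=> e; apply: hc.
  exists g => [|x]; last by rewrite gd subrK.
  (* With d g = f - h d, the new defect d (f x - g (d x)) reduces to h (d (d x)), which is 0. *)
  split=> // x; rewrite linearB [X in _ - X]gd /= fd.
  rewrite opprB addrC subrK.
  have -> : aug_diff F i (aug_diff F i.+1 x) = 0 by exact: aug_cycle_diff x.
  by rewrite linear0.
exists h; split=> [x|i|i x].
- by rewrite h0.
- by case: (hPQ i) => -[].
- by case: (hPQ i) => _; apply.
Qed.

Definition tensor_aug F G i j (f : {linear aug_mod F i.+1 -> aug_mod G j.+1}) :
    {linear {freeg (Defs.basis F i) / k} -> {freeg (Defs.basis G j) / k}} :=
  fglift (fun e => reduce_mod (f << e >> : {freeg (Defs.basis G j) / R})).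

Lemma tensor_augE F G i j (f : {linear aug_mod F i.+1 -> aug_mod G j.+1}) :
  tensor_aug f =
  tensor_k (f : {freeg (Defs.basis F i) / R} -> {freeg (Defs.basis G j) / R})
  :> (_ -> _).
Proof. by []. Qed.

Lemma tensor_aug_comp F G H i j l
    (f : {linear aug_mod F i.+1 -> aug_mod G j.+1})
    (g : {linear aug_mod G j.+1 -> aug_mod H l.+1})
    (u : {freeg (Defs.basis F i) / R} -> {freeg (Defs.basis H l) / R}) z :
  (forall x, u x = g (f x)) -> tensor_k u z = tensor_aug g (tensor_aug f z).
Proof.
move=> ufg; rewrite !tensor_augE.
rewrite -(tensor_k_comp (f : {linear {freeg _ / R} -> {freeg _ / R}})
                        (g : {linear {freeg _ / R} -> {freeg _ / R}})).
by apply: eq_tensor_k => x; rewrite ufg.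
Qed.

(** A coefficient that survives reduction has a nonzero constant term, and the monomial 1 has degree
    0; the basis element it multiplies must then have the degree of [e] itself. *)
Lemma tensor_homog_linear F G i j b
    (f : {linear aug_mod F i.+1 -> aug_mod G j.+1}) z :
    (forall c (x : aug_mod F i.+1), aug_homog c x -> aug_homog c (f x)) ->
  tensor_homog (F := F) b z -> tensor_homog (F := G) b (tensor_aug f z).
Proof.
move=> hf zb; apply: (dom_fglift_sub (D := fun e => bdeg e = b)) => // e eb e'.
rewrite mem_dom coeff_reduce_mod -mcoeff_msupp => e0.
by have := hf _ _ (free_homogU _ e) _ _ e0; rewrite degA0 add0r eb.
Qed.

Lemma tensor_homog_subspace F i b : subspace (@tensor_homog _ _ _ _ _ F i b).
Proof.
split; first by move=> e; rewrite dom0.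
by move=> a u v; apply: dom_linearP.
Qed.

Lemma tensor_cycle_subspace F i : subspace (@tensor_cycle _ _ _ _ _ F i).
Proof.
case: i => [|i] //; split; rewrite /tensor_cycle /tensor_k ?linear0 //.
by move=> a u v; rewrite linearP /= => -> ->; rewrite scaler0 addr0.
Qed.

Section ChainMap.
Context F G (f : forall i, {linear aug_mod F i -> aug_mod G i}).
Hypothesis fd : forall i x, aug_diff G i (f i.+1 x) = f i (aug_diff F i x).

Lemma tensor_chain_map i z :
  tensor_aug (aug_diff G i.+1) (tensor_aug (f i.+2) z)
  = tensor_aug (f i.+1) (tensor_aug (aug_diff F i.+1) z).
Proof.
pose u (x : aug_mod F i.+2) := aug_diff G i.+1 (f i.+2 x).
rewrite -(@tensor_aug_comp _ _ _ _ _ _ _ _ u) //.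
by apply: tensor_aug_comp => x; apply: (fd (i := i.+1)).
Qed.

Lemma tensor_cycle_map i z :
  tensor_cycle (F := F) z -> tensor_cycle (F := G) (tensor_aug (f i.+1) z).
Proof.
case: i z => // i z zc.
rewrite /tensor_cycle -[LHS]/(tensor_aug (aug_diff G i.+1) _) tensor_chain_map.
by rewrite [X in tensor_aug _ X]zc linear0.
Qed.

Hypothesis f0 : forall x, f 0%N x = x.
Hypothesis fh : forall i b x, aug_homog b x -> aug_homog b (f i x).

Context (g : forall i, {linear aug_mod G i -> aug_mod F i}).
Hypothesis gd : forall i x, aug_diff F i (g i.+1 x) = g i (aug_diff G i x).
Hypothesis g0 : forall x, g 0%N x = x.
Hypothesis gh : forall i b x, aug_homog b x -> aug_homog b (g i x).

(** The map g f - id lifts the zero map of M, hence equals d h + h d. After tensoring, h d kills the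
    cycle [z] and d h contributes the boundary. *)
Lemma tensor_homotopy i b z :
    tensor_homog (F := F) b z -> tensor_cycle (F := F) z ->
  exists2 y, tensor_homog (F := F) b y
    & tensor_aug (g i.+1) (tensor_aug (f i.+1) z) = z + tensor_k (diff F i) y.
Proof.
move=> zb zc.
have [|||h [h0 hh hd]] := @null_homotopy F (fun i => [the {linear _ -> _} of
   (g i \o f i) \- idfun]).
- by move=> x; rewrite /= f0 g0 subrr.
- by move=> j c x hx; apply: free_homogB => //;
  exact/(gh (i := j.+1))/(fh (i := j.+1)).
- by move=> j x; rewrite /= linearB /= gd fd.
have gfE x : g i.+1 (f i.+1 x)
    = x + (diff F i (h i.+1 x) + h i (aug_diff F i x)).
  by rewrite -[diff F i _]/(aug_diff F i.+1 _) -hd /= addrC subrK.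
exists (tensor_aug (h i.+1) z); first exact: (tensor_homog_linear (hh i.+1)).
pose u (x : {freeg (Defs.basis F i) / R}) := diff F i (h i.+1 x).
rewrite -(@tensor_aug_comp _ _ _ _ _ _ _ _ (fun x => g i.+1 (f i.+1 x))) //.
rewrite -[X in _ = _ + X](@tensor_aug_comp _ _ _ _ _ _ _ (aug_diff F i.+1) u)
  //.
rewrite -{2}(tensor_k_id n z) -tensor_kD.
(* In degree 0 the term h d is zero because [h 0] is; in positive degree it is the map [v], which
   vanishes on [z] by the cycle condition. *)
case: i z zb zc gfE @u => [|j] z zb zc gfE u.
  by apply: eq_tensor_k => x /=; rewrite gfE h0 addr0.
pose v (x : {freeg (Defs.basis F j.+1) / R}) :
  {freeg (Defs.basis F j.+1) / R} :=
  h j.+1 (diff F j x).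
rewrite (eq_tensor_k (g := (idfun \+ u) \+ v)); last first.
  by move=> x; rewrite gfE addrA.
rewrite [LHS]tensor_kD.
rewrite (tensor_aug_comp (f := aug_diff F j.+1) (g := h j.+1) (u := v)) //.
by rewrite [X in tensor_aug (h j.+1) X]zc linear0 addr0.
Qed.

End ChainMap.

(** The comparison maps in the two directions are mutually inverse on homology; the homotopy for g f
    yields injectivity, the one for f g surjectivity. *)
Lemma tensor_homology_dim_indep F G i b d :
  tensor_homology_dim F i b d -> tensor_homology_dim G i b d.
Proof.
have [f [f0 fh fd]] := comparison_map F G.
have [g [g0 gh gd]] := comparison_map G F.
apply: (has_dim_quotient_iso (f := tensor_aug (f i.+1))).
- split; first by split; [exact: (tensor_homog_subspace F i b).1
                         |exact: (tensor_cycle_subspace F i).1].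
  move=> a u v [ub uc] [vb vc]; split.
    exact: (tensor_homog_subspace F i b).2.
  exact: (tensor_cycle_subspace F i).2.
- split; first by exists 0; rewrite /tensor_k ?linear0 // => e; rewrite dom0.
  move=> a _ _ [u ub ->] [v vb ->]; exists (a *: u + v).
    exact: (tensor_homog_subspace G i.+1 b).2.
  by rewrite /tensor_k linearP.
- move=> z [zb zc]; split; first exact: (tensor_homog_linear (fh i.+1)).
  exact: (tensor_cycle_map fd).
- move=> z [zb zc]; split=> [[y yb ->]|[y yb zy]].
    exists (tensor_aug (f i.+2) y);
      first exact: (tensor_homog_linear (fh i.+2)).
    exact/esym/(tensor_chain_map fd).
  have [y2 y2b] := tensor_homotopy fd f0 fh gd g0 gh zb zc.
  rewrite zy -[tensor_k _ y]/(tensor_aug (aug_diff G i.+1) y).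
  rewrite -(tensor_chain_map gd) => E.
  exists (tensor_aug (g i.+2) y - y2); last first.
    by rewrite -[RHS]/(tensor_aug (aug_diff F i.+1) _) linearB E addrK.
  apply: (subspaceB (tensor_homog_subspace F i.+1 b)) => //.
  exact: (tensor_homog_linear (gh i.+2)).
- move=> w [wb wc]; exists (tensor_aug (g i.+1) w).
    split; first exact: (tensor_homog_linear (gh i.+1)).
    exact: (tensor_cycle_map gd).
  have [y yb E] := tensor_homotopy gd g0 gh fd f0 fh wb wc.
  exists (- y).
    by rewrite -scaleN1r; apply: (subspaceZ _ (tensor_homog_subspace G i.+1 b)).
  by rewrite E /tensor_k linearN /= opprD addrA subrr add0r.
Qed.

End Comparison.

(** * The grading of the lattice ring *)

Section LatticeRingGrading.
Context (k : fieldType) (n : nat) (L : zmodClosed 'rV[int]_n).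
Local Notation R := {mpoly k[n]}.
Local Notation I := (@lattice_ideal k n L).
Implicit Types (b c : {quot L}) (p q : R).

Definition quotient_map : R -> lattice_ring k L := \pi_{ideal_quot I}%qT.

Lemma quotient_map0 : quotient_map 0 = 0.
Proof. exact: raddf0. Qed.

Lemma quotient_mapD : {morph quotient_map : p q / p + q}.
Proof. exact: raddfD. Qed.

Lemma quotient_mapZ p q : quotient_map (p * q) = p *: quotient_map q.
Proof. by rewrite /quotient_map rmorphM. Qed.

Lemma quotient_map_eq p q : quotient_map p = quotient_map q <-> p - q \in I.
Proof. by rewrite Quotient.idealrBE; split=> [/eqP|/eqP]. Qed.

Lemma quotient_map_eq0 p : quotient_map p = 0 <-> p \in I.
Proof. by rewrite -quotient_map0 quotient_map_eq subr0. Qed.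

(** Multiplying a lattice binomial by a monomial gives a lattice binomial again, so these binomials
    already span the ideal over [k]. *)
Lemma lattice_ideal_ind (P : R -> Prop) :
    P 0 -> (forall p q, P p -> P q -> P (p + q)) ->
    (forall (a : k) u v, degA L u = degA L v -> P (a *: ('X_[u] - 'X_[v]))) ->
  forall p, p \in I -> P p.
Proof.
move=> P0 PD PX _ /ideal_spanP[s Ss ->]; rewrite big_seq.
elim/big_rec: _ => // -[r q] p /Ss[u [v [/degA_eq uv /= ->]]] Pp.
apply: (PD) => //; elim/mpolyind: r => [|c m r _ _ IH]; first by rewrite mul0r.
rewrite mulrDl; apply: (PD) => //; rewrite -scalerAl mulrBr -!mpolyXD.
by apply: PX; rewrite !degAD uv.
Qed.

Definition poly_part b p : R :=
  fgsum (fun m a => if degA L m == b then a *: 'X_[m] else 0) (mpoly_val p).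

Let partD b m : {morph (fun a : k =>
  if degA L m == b then a *: 'X_[m] else 0 : R) : a a' / a + a'}.
Proof. by move=> a a'; case: ifP; rewrite ?addr0 // scalerDl. Qed.

Lemma poly_partD b : {morph poly_part b : p q / p + q}.
Proof. by move=> p q; rewrite /poly_part -fgsumD. Qed.

Lemma poly_partB b : {morph poly_part b : p q / p - q}.
Proof. by move=> p q; rewrite /poly_part -fgsumB. Qed.

Lemma poly_part0 b : poly_part b 0 = 0.
Proof. by apply: (addrI (poly_part b 0)); rewrite -poly_partD !addr0. Qed.

Lemma poly_partX b (c : k) m :
  poly_part b (c *: 'X_[m]) = if degA L m == b then c *: 'X_[m] else 0.
Proof. by rewrite -[in LHS]MPolyU /poly_part fgsumU. Qed.

Lemma poly_partE b c p :
  poly_homog c p -> poly_part b p = if c == b then p else 0.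
Proof.
move=> hp; rewrite (mpolyE p) big_seq.
apply: (big_rec (fun q => poly_part b q = if c == b then q else 0)).
  by rewrite poly_part0 if_same.
move=> m q /hp <- IH.
by rewrite poly_partD poly_partX IH; case: ifP; rewrite ?addr0.
Qed.

(** The ideal is homogeneous: both monomials of a spanning binomial have the same degree, so
    projection keeps the binomial or kills it. *)
Lemma poly_part_ideal b p : p \in I -> poly_part b p \in I.
Proof.
elim/lattice_ideal_ind => {p}[|p q pI qI|c u v uv].
- by rewrite poly_part0; apply: ideal_span0.
- by rewrite poly_partD rpredD.
rewrite scalerBr poly_partB !poly_partX uv; case: ifP => _; last first.
  by rewrite subrr; apply: ideal_span0.
apply/ideal_spanP; exists [:: (c%:MP, 'X_[u] - 'X_[v])].
  move=> t; rewrite inE => /eqP ->; exists u, v; split=> //.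
  exact/degA_eq.
by rewrite big_seq1 /= mul_mpolyC scalerBr.
Qed.

Lemma lattice_ring_cover
    (F : graded_free_resolution (@lattice_ring_homog k n L)) b y :
    lattice_ring_homog b y ->
  exists2 x, free_homog (bdeg (g := F) (i := 0)) b x & augm F x = y.
Proof.
case=> p hp ->; have [x xE] := augm_surj F (quotient_map p).
pose deg := bdeg (g := F) (i := 0).
exists (homog_part deg b x); first exact: homog_part_homog.
(* No projection to degree [b] is available on the quotient ring, so a representative [q] of the
   image is carried along and projected instead. It differs from [p] by an element of the ideal, and
   so do their degree [b] parts. *)
suff [q qx qxb] : exists2 q, augm F x = quotient_map q
    & augm F (homog_part deg b x) = quotient_map (poly_part b q).
  rewrite qxb; apply/quotient_map_eq.
  move: qx; rewrite xE => /quotient_map_eq/(poly_part_ideal b).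
  rewrite poly_partB (poly_partE b hp) eqxx => H.
  by rewrite -opprB rpredN.
elim/freeg_mpoly_ind: x {xE}.
- by exists 0; rewrite ?poly_part0 ?homog_part0 linear0 quotient_map0.
- move=> x z [q Eq Eqb] [r Er Erb]; exists (q + r).
    by rewrite linearD Eq Er quotient_mapD.
  by rewrite homog_partD linearD Eqb Erb poly_partD quotient_mapD.
- move=> c m e; have [q hq qE] := augm_homog (free_homogU (k := k) deg e).
  have E : augm F ((c *: 'X_[m]) *: << e >>) = quotient_map (c *: 'X_[m] * q).
    by rewrite linearZ /= qE quotient_mapZ.
  exists (c *: 'X_[m] * q) => //; rewrite homog_part_term.
  rewrite (@poly_partE b (degA L m + deg e)).
    by case: ifP; rewrite ?E ?linear0 ?quotient_map0.
  move=> m' /msuppM_le/allpairsP[[m1 m2] /= [m1p m2q ->]].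
  by rewrite degAD (poly_homogX L m1p) (hq _ m2q).
Qed.

End LatticeRingGrading.

(** * Cones in the chain complex of a full simplex *)

Section Cone.
Context (k : fieldType) (disp : Order.disp_t) (V : orderType disp).
Local Notation C := {freeg {fset V} / k}.
Implicit Types (S T : {fset V}) (p v : V).

Definition face_sign T v : k := (-1) ^+ #|` [fset w in T | (w < v)%O]%fset|.

Lemma face_sign_fsetU1 p T v :
  p \notin T -> face_sign (p |` T)%fset v = (-1) ^+ (p < v)%O * face_sign T v.
Proof.
move=> pT; rewrite /face_sign -exprD; congr (_ ^+ _).
have [pv|/negPf pv] /= := boolP (p < v)%O.
  have -> : [fset w in (p |` T)%fset | (w < v)%O]%fset
            = (p |` [fset w in T | (w < v)%O])%fset.
    by apply/fsetP => w; rewrite !inE /=; case: (eqVneq w p) => //= ->;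
      rewrite pv.
  by rewrite cardfsU1 !inE (negPf pT).
have -> : [fset w in (p |` T)%fset | (w < v)%O]%fset
          = [fset w in T | (w < v)%O]%fset.
  by apply/fsetP => w; rewrite !inE /=; case: (eqVneq w p) => //= ->;
    rewrite pv (negPf pT).
by [].
Qed.

Lemma face_sign_sqr T v : face_sign T v * face_sign T v = 1.
Proof. by rewrite -expr2 sqrr_sign. Qed.

Lemma boundaryU T :
  boundary (<< T >> : C) = \sum_(v <- T) face_sign T v *: << (T `\ v)%fset >>.
Proof. exact: fgliftU1. Qed.

(** The sign is that of [p] at its sorted position in the enlarged set, so that deleting [p] in the
    boundary returns the face with coefficient 1. *)
Definition cone p : {linear C -> C} := fglift (fun T : {fset V} =>
  if p \in T then 0 else face_sign T p *: << (p |` T)%fset >>).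

Lemma coneU p T : cone p << T >> =
  if p \in T then 0 else face_sign T p *: << (p |` T)%fset >>.
Proof. exact: fgliftU1. Qed.

Lemma boundary_is_linear : linear (@boundary _ V k).
Proof. exact: fglift_linear. Qed.

HB.instance Definition _ :=
  GRing.isLinear.Build k C C _ (@boundary _ V k) boundary_is_linear.

Lemma boundary_cone p (c : C) : boundary (cone p c) + cone p (boundary c) = c.
Proof.
pose f : {linear C -> C} :=
  (@boundary _ V k \o cone p) \+ (cone p \o @boundary _ V k).
rewrite -[LHS]/(f c) -[RHS]/((idfun : {linear C -> C}) c).
apply: linear_freeg_eq => T; rewrite /f /= boundaryU raddf_sum /= coneU.
(* If [p] lies in [T], the cone kills [T] and every facet but the one opposite [p]. Otherwise that
   facet of the cone is [T], and the remaining facets cancel against the cone of the boundary. *)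
have [pT|pT] := boolP (p \in T).
  have [S pS ->] : exists2 S, p \notin S & T = (p |` S)%fset.
    by exists (T `\ p)%fset; rewrite ?fsetD1K // !inE eqxx.
  rewrite linear0 add0r big_fsetU1 //= linearZ /= fsetU1K // coneU (negPf pS).
  rewrite scalerA face_sign_fsetU1 // ltxx mul1r face_sign_sqr scale1r.
  rewrite big_seq big1 ?addr0 // => v vS.
  have pv : p != v by apply: contraNneq pS => ->.
  by rewrite [cone p _]linearZ /= coneU !inE eqxx pv scaler0.
rewrite linearZ /= boundaryU big_fsetU1 //= fsetU1K // scalerDr scalerA.
rewrite face_sign_fsetU1 // ltxx mul1r face_sign_sqr scale1r -addrA.
rewrite scaler_sumr -big_split /= big_seq big1 ?addr0 // => v vT.
have pv : p != v by apply: contraNneq pT => ->.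
have vTv : v \notin (T `\ v)%fset by rewrite !inE eqxx.
have pTv : p \notin (T `\ v)%fset by rewrite !inE (negPf pT) andbF.
have -> : ((p |` T) `\ v)%fset = (p |` (T `\ v))%fset.
  by apply/fsetP => w; rewrite !inE; case: (eqVneq w p) => //= ->; rewrite pv.
rewrite [cone p _]linearZ /= coneU (negPf pTv) !scalerA -scalerDl.
have -> : face_sign T p = (-1) ^+ (v < p)%O * face_sign (T `\ v)%fset p.
  by rewrite -face_sign_fsetU1 // fsetD1K.
rewrite face_sign_fsetU1 // -[X in _ + X]mul1r.
set s := face_sign _ p; set t := face_sign T v.
have -> : (-1) ^+ (v < p)%O * s * ((-1) ^+ (p < v)%O * t)
          = (-1) ^+ (v < p)%O * (-1) ^+ (p < v)%O * (t * s).
  by rewrite -!mulrA; congr (_ * _); rewrite mulrCA [s * t]mulrC.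
(* Exactly one of the two comparisons holds, so the product of the signs is -1. *)
rewrite -mulrDl; case: (ltgtP p v) pv => //= _ _.
  by rewrite expr0 expr1 mul1r addNr mul0r scale0r.
by rewrite expr0 expr1 mulr1 addNr mul0r scale0r.
Qed.

(** Every nonempty face is, up to sign, a cone over a smaller one, and applying the identity of
    [boundary_cone] twice leaves the cone of a double boundary, zero by induction. No double sum of
    signs occurs. *)
Lemma boundary_boundary (c : C) : boundary (boundary c) = 0.
Proof.
pose f : {linear C -> C} := @boundary _ V k \o @boundary _ V k.
rewrite -[LHS]/(f c) -[RHS]/((\0 : {linear C -> C}) c).
apply: linear_freeg_eq => T; rewrite /f /=.
have [m] := ubnP #|` T|; elim: m T => // m IH T Tm.
have [->|[p pT]] := fset_0Vmem T;
  first by rewrite boundaryU big_seq_fset0 linear0.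
set S := (T `\ p)%fset.
have pS : p \notin S by rewrite !inE eqxx.
have -> : << T >> = face_sign S p *: cone p << S >>.
  by rewrite coneU (negPf pS) scalerA face_sign_sqr scale1r fsetD1K.
rewrite !linearZ /=.
have E d : boundary (cone p d) = d - cone p (boundary d).
  by rewrite -{2}(boundary_cone p d) addrK.
rewrite E linearB /= E IH; first by rewrite linear0 subr0 subrr scaler0.
apply: leq_trans (_ : #|` S| < #|` T|)%N _; last by rewrite -ltnS.
by rewrite [X in (_ < X)%N](cardfsD1 p T) pT.
Qed.

Lemma dom_boundaryU S T : S \in dom (boundary (<< T >> : C)) ->
  exists2 v, v \in T & S = (T `\ v)%fset.
Proof.
rewrite boundaryU => /dom_sum_subset /flattenP[s /mapP[v]].
rewrite mem_filter /= => vT ->; rewrite -freegUZ => /dom_freegU_sub ->.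
by exists v.
Qed.

Lemma dom_coneU p S T :
  S \in dom (cone p << T >>) -> p \notin T /\ S = (p |` T)%fset.
Proof.
rewrite coneU; have [_|pT] := boolP (p \in T); first by rewrite dom0.
by rewrite -freegUZ => /dom_freegU_sub ->; split.
Qed.

End Cone.

(** * Translation of finite sets of monomials *)

Section Translation.
Context (n : nat).
Local Notation X := 'X_{1..n}.
Implicit Types (m u : X) (S T : {fset X}).

Lemma leq_mgcds (s : seq X) (i : 'I_n) c : s != [::] ->
  (c <= mgcds s i)%N = all (fun u : X => c <= u i)%N s.
Proof.
move=> s0.
have step x (t : seq X) : (c <= (\big[@mgcd n/x]_(u <- t) u) i)%N
    = all (fun u : X => c <= u i)%N (x :: t).
  elim: t => [|y t IH]; first by rewrite big_nil /= andbT.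
  by rewrite big_cons mnmE leq_min IH /= andbCA.
(* The head is counted twice, as default value and as member. *)
by rewrite /mgcds step; case: s s0 => //= x s _; rewrite andbA andbb.
Qed.

Lemma fset_neq_nil T : T != fset0 -> (T : seq X) != [::].
Proof. by rewrite -size_eq0 cardfs_eq0. Qed.

Lemma mgcds_le T u : u \in T -> (mgcds T <= u)%MM.
Proof.
move=> uT; apply/mnm_lepP => i; have T0 : (T : seq X) != [::].
  by apply/fset_neq_nil/fset0Pn; exists u.
by have := leqnn (mgcds T i); rewrite leq_mgcds // => /allP/(_ u uT).
Qed.

Definition translate m T : {fset X} := [fset (m + u)%MM | u in T]%fset.

Lemma mem_translate m T u : ((m + u)%MM \in translate m T) = (u \in T).
Proof. by rewrite mem_imfset //; exact: addmI. Qed.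

Lemma translateP m T w :
  reflect (exists2 u, u \in T & w = (m + u)%MM) (w \in translate m T).
Proof. exact: imfsetP. Qed.

Lemma card_translate m T : #|` translate m T| = #|` T|.
Proof. by rewrite card_imfset //; exact: addmI. Qed.

Lemma translate_eq0 m T : (translate m T == fset0) = (T == fset0).
Proof. by rewrite -!cardfs_eq0 card_translate. Qed.

Lemma translate0 T : translate 0%MM T = T.
Proof.
apply/fsetP => u; apply/translateP/idP => [[v vT ->]|uT];
  first by rewrite add0m.
by exists u; rewrite ?add0m.
Qed.

Lemma translateD m m' T :
  translate (m + m')%MM T = translate m (translate m' T).
Proof.
apply/fsetP => u; apply/translateP/translateP =>
  [[v vT ->]|[w /translateP[v vT ->] ->]].
  by exists (m' + v)%MM; rewrite ?mem_translate // addmA.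
by exists v; rewrite // addmA.
Qed.

Lemma translate_fsetD1 m T u :
  (translate m T `\ (m + u)%MM)%fset = translate m (T `\ u)%fset.
Proof.
apply/fsetP => w; rewrite !inE; apply/andP/translateP.
  case=> wu /translateP[v vT wE]; exists v => //; rewrite !inE vT andbT.
  by apply: contraNneq wu => <-; rewrite wE.
case=> v; rewrite !inE => /andP[vu vT] ->.
by rewrite (inj_eq (@addmI _ m)) mem_translate.
Qed.

Lemma mgcds_translate m T :
  T != fset0 -> mgcds (translate m T) = (m + mgcds T)%MM.
Proof.
move=> T0; have T0' := fset_neq_nil T0.
have mT0 : (translate m T : seq X) != [::].
  by rewrite fset_neq_nil ?translate_eq0.
apply/mnmP => i; rewrite mnmDE; apply/eqP; rewrite eqn_leq; apply/andP; split.
  rewrite -leq_subLR leq_mgcds //; apply/allP => u uT.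
  rewrite leq_subLR -mnmDE; apply/mnm_lepP: i; apply: mgcds_le.
  by rewrite mem_translate.
rewrite leq_mgcds //; apply/allP => w /translateP[u uT ->].
rewrite mnmDE leq_add2l; apply/mnm_lepP: i; exact: mgcds_le.
Qed.

Definition strip T : {fset X} := [fset (u - mgcds T)%MM | u in T]%fset.

Lemma stripK T : translate (mgcds T) (strip T) = T.
Proof.
apply/fsetP => u; apply/translateP/idP.
  case=> w /imfsetP[v /= vT ->] ->.
  by rewrite addmC submK // mgcds_le.
move=> uT; exists (u - mgcds T)%MM; last by rewrite addmC submK // mgcds_le.
by apply/imfsetP; exists u.
Qed.

Lemma card_strip T : #|` strip T| = #|` T|.
Proof. by rewrite -[in RHS](stripK T) card_translate. Qed.

Lemma mgcds_strip T : T != fset0 -> mgcds (strip T) = 0%MM.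
Proof.
move=> T0; apply: (@addmI _ (mgcds T)); rewrite addm0 -mgcds_translate.
  by rewrite stripK.
by rewrite -cardfs_eq0 card_strip cardfs_eq0.
Qed.

(** Uniqueness of the decomposition: a translate by [m] of a set with gcd 1 has gcd [m], so
    stripping undoes the translation. *)
Lemma translateK m T :
  T != fset0 -> mgcds T = 0%MM -> strip (translate m T) = T.
Proof.
move=> T0 gT; have gmT : mgcds (translate m T) = m.
  by rewrite mgcds_translate // gT addm0.
apply/fsetP => u; apply/imfsetP/idP => /=.
  by case=> w /translateP[v vT ->] ->; rewrite gmT addmC addmK.
by move=> uT; exists (m + u)%MM; rewrite ?mem_translate // gmT addmC addmK.
Qed.

Context (k : fieldType).
Local Notation C := {freeg {fset X} / k}.

Definition translate_chain m : {linear C -> C} :=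
  fglift (fun T => << translate m T >>).

Lemma translate_chainU m T : translate_chain m << T >> = << translate m T >>.
Proof. exact: fgliftU1. Qed.

(** The order on monomials is compatible with multiplication, so a translation keeps the relative
    positions of the vertices. *)
Lemma face_sign_translate m T u :
  face_sign k (translate m T) (m + u)%MM = face_sign k T u.
Proof.
rewrite /face_sign; congr (_ ^+ _).
rewrite -(card_translate m [fset w in T | (w < u)%O]%fset); congr (#|` _|).
apply/fsetP => w; rewrite !inE /=; apply/andP/translateP.
  by case=> /translateP[v vT ->]; rewrite ltmc_add2r => vu; exists v;
    rewrite ?inE ?vT.
by case=> v; rewrite !inE /= => /andP[vT vu] ->;
  rewrite mem_translate ltmc_add2r.
Qed.

Lemma boundary_translate m (c : C) :
  boundary (translate_chain m c) = translate_chain m (boundary c).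
Proof.
pose f : {linear C -> C} := @boundary _ X k \o translate_chain m.
pose g : {linear C -> C} := translate_chain m \o @boundary _ X k.
rewrite -[LHS]/(f c) -[RHS]/(g c); apply: linear_freeg_eq => T.
rewrite /f /g /= translate_chainU !boundaryU raddf_sum /= big_imfset /=;
  last first.
  by move=> u v _ _; apply: addmI.
apply: eq_bigr => u _; rewrite [RHS]linearZ /= translate_chainU.
by rewrite face_sign_translate translate_fsetD1.
Qed.

End Translation.

(** * The resolution by subsets of fibers *)

Section FiberResolution.
Context (k : fieldType) (n : nat) (L : zmodClosed 'rV[int]_n).
Local Notation R := {mpoly k[n]}.
Local Notation X := 'X_{1..n}.
Local Notation C := {freeg {fset X} / k}.
Implicit Types (i : nat) (T S : {fset X}) (b : {quot L}).

Definition one_fiber i T : Prop :=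
  #|` T| = i.+1 /\ forall u v, u \in T -> v \in T -> degA L u = degA L v.

Definition is_cell i T : bool := `[< one_fiber i T /\ mgcds T = 0%MM >].

Definition cell i : choiceType := {T : {fset X} | is_cell i T}.

Definition cell_set i (e : cell i) : {fset X} := val e.

Definition to_cell i T : option (cell i) := insub T.

Lemma one_fiber_neq0 i T : one_fiber i T -> T != fset0.
Proof. by case=> Ti _; rewrite -cardfs_gt0 Ti. Qed.

Lemma cellP i (e : cell i) :
  one_fiber i (cell_set e) /\ mgcds (cell_set e) = 0%MM.
Proof. exact/asboolP/(valP e). Qed.

Lemma cell_neq0 i (e : cell i) : cell_set e != fset0.
Proof. by case: (cellP e) => /one_fiber_neq0. Qed.

Variant to_cell_spec i T : option (cell i) -> Prop :=
| ToCellSome e of cell_set e = T : to_cell_spec T (Some e)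
| ToCellNone of ~ (one_fiber i T /\ mgcds T = 0%MM) : @to_cell_spec i T None.

Lemma to_cellP i T : to_cell_spec T (to_cell i T).
Proof.
rewrite /to_cell; case: insubP => [e _ eT|/asboolPn nT]; [exact: ToCellSome|].
exact: ToCellNone.
Qed.

Lemma to_cellK i (e : cell i) : to_cell i (cell_set e) = Some e.
Proof. exact: valK. Qed.

Lemma cell_set_inj i : injective (@cell_set i).
Proof. exact: val_inj. Qed.

Lemma one_fiber_translate i m T : one_fiber i T -> one_fiber i (translate m T).
Proof.
case=> Ti Tdeg; split; first by rewrite card_translate.
by move=> _ _ /translateP[u uT ->] /translateP[v vT ->];
  rewrite !degAD (Tdeg u v).
Qed.

Lemma one_fiber_strip i T : one_fiber i T -> one_fiber i (strip T).
Proof.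
case=> Ti Tdeg; split; first by rewrite card_strip.
move=> u v uT vT; apply: (addrI (degA L (mgcds T))); rewrite -!degAD.
by apply: Tdeg; rewrite -[in X in _ \in X](stripK T) mem_translate.
Qed.

Lemma one_fiberD1 i T u :
  one_fiber i.+1 T -> u \in T -> one_fiber i (T `\ u)%fset.
Proof.
case=> Ti Tdeg uT; split; first by move: Ti; rewrite (cardfsD1 u) uT => -[].
by move=> v w; rewrite !inE => /andP[_ vT] /andP[_ wT]; apply: Tdeg.
Qed.

Lemma one_fiberU1 i T p : one_fiber i T -> p \notin T ->
  (forall u, u \in T -> degA L u = degA L p) -> one_fiber i.+1 (p |` T)%fset.
Proof.
case=> Ti Tdeg pT pdeg; split; first by rewrite cardfsU1 pT Ti.
by move=> u v; rewrite !inE => /predU1P[->|uT] /predU1P[->|vT] //;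
  rewrite ?pdeg //; apply: Tdeg.
Qed.

Definition fiber_chain i (c : C) := forall T, T \in dom c -> one_fiber i T.

Lemma fiber_chain_boundary i c :
  fiber_chain i.+1 c -> fiber_chain i (boundary c).
Proof.
move=> hc; apply: (dom_fglift_sub (D := one_fiber i.+1)) => // T hT S hS.
have /dom_boundaryU[v vT ->] : S \in dom (boundary (<< T >> : C)).
  by rewrite boundaryU.
exact: one_fiberD1.
Qed.

(* Every subset of a fiber is uniquely m + T with T a cell (m is its gcd); it
   corresponds to the element x^m T of the free R-module on the cells. *)
Definition to_free i : C -> {freeg (cell i) / R} :=
  fgsum (fun T c => if to_cell i (strip T) is Some e
                    then (c *: 'X_[mgcds T]) *: << e >> else 0).

Let to_freeD1 i T : {morph (fun c => if to_cell i (strip T) is Some e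
                    then (c *: 'X_[mgcds T] : R) *: << e >> else 0) :
                      a b / a + b}.
Proof. by move=> a b; case: to_cell => [e|]; rewrite ?addr0 // !scalerDl. Qed.

Lemma to_freeD i : {morph @to_free i : x y / x + y}.
Proof. exact: (fgsumD (@to_freeD1 i)). Qed.

Lemma to_free0 i : to_free i 0 = 0.
Proof. by rewrite /to_free /fgsum dom0 big_nil. Qed.

Lemma to_freeU i c T : one_fiber i T -> exists2 e : cell i, cell_set e = strip T
  & to_free i << c *g T >> = (c *: 'X_[mgcds T]) *: << e >>.
Proof.
move=> hT; rewrite /to_free (fgsumU (@to_freeD1 i)).
case: to_cellP => [e eT|[]]; first by exists e.
by split; [exact: one_fiber_strip|apply: mgcds_strip; apply: one_fiber_neq0 hT].
Qed.

Lemma to_free_translate i c m (e : cell i) :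
  to_free i << c *g translate m (cell_set e) >> = (c *: 'X_[m]) *: << e >>.
Proof.
have [he ge] := cellP e; have e0 := cell_neq0 e.
have [e' e'E ->] := to_freeU c (one_fiber_translate m he).
have -> : e' = e by apply: cell_set_inj; rewrite e'E translateK.
by rewrite mgcds_translate // ge addm0.
Qed.

Definition of_free i : {freeg (cell i) / R} -> C :=
  fgterms (fun e m c => << c *g translate m (cell_set e) >>).

Let of_freeD1 i (e : cell i) m : {morph (fun c : k =>
  << c *g translate m (cell_set e) >> : C) : a b / a + b}.
Proof. by move=> a b; rewrite freegUD. Qed.

Lemma of_freeD i : {morph @of_free i : x y / x + y}.
Proof. exact: (fgtermsD (@of_freeD1 i)). Qed.

Lemma of_free0 i : @of_free i 0 = 0.
Proof. exact: fgterms0. Qed.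

Lemma of_free_term i c m (e : cell i) :
  of_free ((c *: 'X_[m]) *: << e >>) = << c *g translate m (cell_set e) >>.
Proof. exact: (fgtermsU (@of_freeD1 i)). Qed.

Lemma fiber_chain_of_free i (x : {freeg (cell i) / R}) :
  fiber_chain i (of_free x).
Proof.
elim/freeg_mpoly_ind: x => [|x y hx hy|c m e].
- by rewrite of_free0 => T; rewrite dom0.
- by rewrite of_freeD => T /domD_subset; rewrite mem_cat => /orP[/hx|/hy].
- rewrite of_free_term => T /dom_freegU_sub ->; apply: one_fiber_translate.
  by case: (cellP e).
Qed.

Lemma of_freeK i : cancel (@of_free i) (to_free i).
Proof.
move=> x; elim/freeg_mpoly_ind: x => [|x y hx hy|c m e].
- by rewrite of_free0 to_free0.
- by rewrite of_freeD to_freeD hx hy.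
- by rewrite of_free_term to_free_translate.
Qed.

Lemma to_freeK i c : fiber_chain i c -> of_free (to_free i c) = c.
Proof.
move=> hc; elim/freeg_ind_dom: c / hc => [|x y hx hy|c T hT].
- by rewrite to_free0 of_free0.
- by rewrite to_freeD of_freeD hx hy.
- have [e eT ->] := to_freeU c hT.
  by rewrite of_free_term eT stripK.
Qed.

(** Scalar multiplication by a monomial becomes translation of chains; with [boundary_translate]
    this makes the boundary correspond to an [R]-linear map. *)
Lemma of_freeZ i c m (x : {freeg (cell i) / R}) :
  of_free ((c *: 'X_[m]) *: x) = c *: translate_chain k m (of_free x).
Proof.
elim/freeg_mpoly_ind: x => [|x y hx hy|a m' e].
- by rewrite scaler0 of_free0 linear0 scaler0.
- by rewrite scalerDr !of_freeD linearD scalerDr hx hy.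
- rewrite scalerA -scalerAl -scalerAr -mpolyXD scalerA !of_free_term translateD.
  by rewrite freegUZ [in RHS]freegUZ linearZ /= translate_chainU scalerA.
Qed.

(** A facet of a cell may acquire a nontrivial gcd; [to_free] turns it into the monomial
    coefficient. *)
Definition free_diff i :
  {linear {freeg (cell i.+1) / R} -> {freeg (cell i) / R}} :=
  fglift (fun e => to_free i (boundary << cell_set e >>)).

Lemma free_diffU i (e : cell i.+1) :
  free_diff i << e >> = to_free i (boundary << cell_set e >>).
Proof. exact: fgliftU1. Qed.

Lemma of_free_diff i (x : {freeg (cell i.+1) / R}) :
  of_free (free_diff i x) = boundary (of_free x).
Proof.
elim/freeg_mpoly_ind: x => [|x y hx hy|c m e].
- by rewrite linear0 !of_free0 linear0.
- by rewrite linearD !of_freeD linearD hx hy.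
- rewrite linearZ /= [LHS]of_freeZ free_diffU to_freeK; last first.
    apply: fiber_chain_boundary => T /dom_freegU_sub ->.
    by case: (cellP e).
  by rewrite of_free_term (freegUZ c) linearZ /= -translate_chainU
    boundary_translate.
Qed.

Lemma free_diff_to_free i c : fiber_chain i.+1 c ->
  free_diff i (to_free i.+1 c) = to_free i (boundary c).
Proof.
by move=> hc; rewrite -[LHS]of_freeK of_free_diff to_freeK.
Qed.

(* It depends on the fiber containing T only, see [apexD1]. *)
Definition apex T : X :=
  choose [pred u | degA L u == degA L (head 0%MM T)] (head 0%MM T).

Lemma head_fset T : T != fset0 -> head 0%MM T \in T.
Proof.
have headP (s : seq X) : s != [::] -> head 0%MM s \in s.
  by case: s => //= x s _; rewrite mem_head.
by move/fset_neq_nil/headP.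
Qed.

Lemma degA_apex i T u : one_fiber i T -> u \in T -> degA L (apex T) = degA L u.
Proof.
move=> hT uT; have h0 := head_fset (one_fiber_neq0 hT).
have /eqP -> : [pred u | degA L u == degA L (head 0%MM T)] (apex T).
  by apply: chooseP; rewrite /= eqxx.
by case: hT => _; apply.
Qed.

Lemma apexD1 i T u : one_fiber i.+1 T -> u \in T -> apex (T `\ u)%fset = apex T.
Proof.
move=> hT uT; have hTu := one_fiberD1 hT uT.
have := head_fset (one_fiber_neq0 hTu); rewrite !inE => /andP[_ h1].
have h0 := head_fset (one_fiber_neq0 hT).
have E : degA L (head 0%MM (T `\ u)%fset) = degA L (head 0%MM T).
  by case: hT => _; apply.
(* The two heads define the same predicate, and [choose] does not depend on which witness it is
   given. *)
by rewrite /apex E; apply: choose_id; rewrite /= ?E.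
Qed.

Definition fiber_cone : {linear C -> C} :=
  fglift (fun T => cone k (apex T) << T >>).

Lemma fiber_chain_cone i c : fiber_chain i c -> fiber_chain i.+1 (fiber_cone c).
Proof.
move=> hc; apply: (dom_fglift_sub (D := one_fiber i)) => // T hT S.
case/dom_coneU => pT ->; apply: one_fiberU1 => // u uT.
by rewrite (degA_apex hT uT).
Qed.

(** Each [T] here has at least two elements, so its facets are nonempty, determine the same fiber
    and share its apex; on [T] and its boundary the map is a single cone. *)
Lemma boundary_fiber_cone i c : fiber_chain i.+1 c ->
  boundary (fiber_cone c) + fiber_cone (boundary c) = c.
Proof.
move=> hc; pose f : {linear C -> C} :=
  (@boundary _ X k \o fiber_cone) \+ (fiber_cone \o @boundary _ X k).
rewrite -[LHS]/(f c) -[RHS]/((idfun : {linear C -> C}) c).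
apply: linear_freeg_eq_dom => T /hc hT;
  rewrite /f /= -[RHS](boundary_cone (apex T)).
congr (boundary _ + _); first exact: fgliftU1.
apply: linear_freeg_eq_dom => S /dom_boundaryU[v vT ->].
by rewrite [LHS]fgliftU1 (apexD1 hT vT).
Qed.

Lemma free_diff_exact i x :
  free_diff i x = 0 <-> exists y, x = free_diff i.+1 y.
Proof.
split=> [dx|[y ->]]; last first.
  rewrite -[LHS]of_freeK !of_free_diff boundary_boundary to_free0 //.
have hx : fiber_chain i.+1 (of_free x) by exact: fiber_chain_of_free.
exists (to_free i.+2 (fiber_cone (of_free x))).
rewrite free_diff_to_free; last exact: fiber_chain_cone.
have := boundary_fiber_cone hx.
by rewrite -of_free_diff dx of_free0 linear0 addr0 => ->; rewrite of_freeK.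
Qed.

Definition cell_deg i (e : cell i) : {quot L} :=
  degA L (head 0%MM (cell_set e)).

Lemma cell_degE i (e : cell i) u : u \in cell_set e -> cell_deg e = degA L u.
Proof.
move=> ue; have h0 := head_fset (cell_neq0 e).
by case: (cellP e) => -[_ h] _; apply: h.
Qed.

Lemma to_free_homog i b c : fiber_chain i c ->
    (forall T u, T \in dom c -> u \in T -> degA L u = b) ->
  free_homog (@cell_deg i) b (to_free i c).
Proof.
move=> hc cb.
have {}hc T : T \in dom c -> one_fiber i T /\ forall u, u \in T -> degA L u = b.
  by move=> Tc; split; [exact: hc|move=> u; exact: cb].
elim/freeg_ind_dom: c / hc {cb} => [|x y hx hy|c T [hT Tb]].
- by rewrite to_free0; apply: free_homog0.
- by rewrite to_freeD; apply: free_homogD.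
have [e eT ->] := to_freeU c hT.
have h0 : head 0%MM (cell_set e) \in strip T.
  by rewrite -eT head_fset ?cell_neq0.
have <- : degA L (mgcds T) + cell_deg e = b; last exact: free_homog_term.
by rewrite -degAD; apply: Tb; rewrite -[X in _ \in X]stripK mem_translate.
Qed.

Lemma free_diff_homog i b x : free_homog (@cell_deg i.+1) b x ->
  free_homog (@cell_deg i) b (free_diff i x).
Proof.
apply: linear_homog => e; rewrite free_diffU; apply: to_free_homog.
  apply: fiber_chain_boundary => T /dom_freegU_sub ->.
  by case: (cellP e).
move=> T u /dom_boundaryU[v ve ->]; rewrite !inE => /andP[_ ue].
by rewrite (cell_degE ue).
Qed.

Lemma degA_in_semigroup m : in_semigroup (degA L m).
Proof. by exists (fun j => m j). Qed.

(** A single monomial is its own gcd, so the only cell of dimension 0 is the monomial 1 and G_0 is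
    [R] in degree 0. *)
Lemma cell0P (e : cell 0) : cell_set e = [fset 0%MM]%fset.
Proof.
have [[e1 _] ge] := cellP e.
have /cardfs1P[u eu] : #|` cell_set e| == 1%N by rewrite e1.
rewrite eu; congr [fset _]%fset; apply/mnmP => j; rewrite mnm0E; apply/eqP.
have := leq_mgcds j 1 (fset_neq_nil (cell_neq0 e)); rewrite ge mnm0E => /esym.
by apply: contraFT; rewrite -lt0n => uj; apply/allP => v;
  rewrite eu inE => /eqP ->.
Qed.

Lemma cell_deg0 (e : cell 0) : cell_deg e = 0.
Proof. by rewrite (@cell_degE _ _ 0%MM) ?degA0 // cell0P inE. Qed.

Lemma is_cell0 : is_cell 0 [fset 0%MM]%fset.
Proof.
apply/asboolP; split; first split; first by rewrite cardfs1.
  by move=> u v /fset1P -> /fset1P ->.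
have /mgcds_le : (0%MM : X) \in [fset 0%MM]%fset by rewrite inE.
move=> /mnm_lepP H; apply/mnmP => j; rewrite mnm0E; apply/eqP.
by rewrite -leqn0; have := H j; rewrite mnm0E.
Qed.

Definition cell0 : cell 0 := exist (fun T => is_cell 0 T) _ is_cell0.

Lemma cell0_uniq (e : cell 0) : e = cell0.
Proof. by apply: cell_set_inj; rewrite !cell0P. Qed.

Lemma freeg_cell0 (x : {freeg (cell 0) / R}) : x = coeff cell0 x *: << cell0 >>.
Proof.
apply/eqP/freeg_eqP => e.
by rewrite (cell0_uniq e) coeffZ coeffU eqxx !mulr1.
Qed.

Definition free_augm : {linear {freeg (cell 0) / R} -> lattice_ring k L} :=
  fglift (fun=> quotient_map L (1 : R)).

Lemma free_augmE (p : R) e : free_augm (p *: << e >>) = quotient_map L p.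
Proof. by rewrite linearZ /= [free_augm _]fgliftU1 -quotient_mapZ mulr1. Qed.

Lemma free_augm_homog b x :
  free_homog (@cell_deg 0) b x -> lattice_ring_homog b (free_augm x).
Proof.
rewrite (freeg_cell0 x) free_augmE => hx; exists (coeff cell0 x) => // m mx.
have := hx cell0 m; rewrite coeffZ coeffU eqxx !mulr1 cell_deg0 addr0.
exact.
Qed.

Lemma free_augm_surj y : exists x, free_augm x = y.
Proof.
exists (repr y *: << cell0 >>); rewrite free_augmE; exact: reprK.
Qed.

Lemma to_free_vertex (c : k) u :
  to_free 0 << c *g [fset u]%fset >> = (c *: 'X_[u]) *: << cell0 >>.
Proof.
rewrite -(to_free_translate c u cell0) cell0P; congr (to_free _ << c *g _ >>).
by rewrite /translate imfset_fset1 addm0.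
Qed.

(** This is [boundary_cone] with apex [v] on the vertex [u], which spares any case distinction on
    the order of [u] and [v]. *)
Lemma boundary_edge u v : u != v ->
  boundary (face_sign k [fset u]%fset v *: << (v |` [fset u])%fset >> : C)
  = << [fset u]%fset >> - << [fset v]%fset >>.
Proof.
move=> uv; have vu : v \notin [fset u]%fset by rewrite inE eq_sym.
have := boundary_cone v (<< [fset u]%fset >> : C).
have cE : cone k v << fset0 >> = << [fset v]%fset >>.
  rewrite coneU inE fsetU0 /face_sign.
  have -> : [fset w in fset0 | (w < v)%O]%fset = fset0 :> {fset X}.
    by apply/fsetP => w; rewrite !inE.
  by rewrite cardfs0 scale1r.
have bE : boundary << [fset u]%fset >> = << fset0 >> :> C.
  rewrite boundaryU big_seq_fset1 fsetDv /face_sign.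
  have -> : [fset w in [fset u] | (w < u)%O]%fset = fset0 :> {fset X}.
    by apply/fsetP => w; rewrite !inE; case: eqP => // ->; rewrite ltxx.
  by rewrite cardfs0 scale1r.
by rewrite coneU (negPf vu) bE cE => /(canRL (addrK _)).
Qed.

Lemma free_augm_exact x : free_augm x = 0 <-> exists y, x = free_diff 0 y.
Proof.
split=> [|[y ->]].
  rewrite (freeg_cell0 x) free_augmE => /quotient_map_eq0.
  move: (coeff _ _) => p;
    elim/lattice_ideal_ind => {p x}[|p q [y yE] [z zE]|c u v uv].
  - by exists 0; rewrite linear0 scale0r.
  - by exists (y + z); rewrite scalerDl linearD yE zE.
  (* Equal monomials span no edge, but their binomial is zero. *)
  have [->|neq_uv] := eqVneq u v.
    by exists 0; rewrite subrr scaler0 scale0r linear0.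
  pose s := face_sign k [fset u]%fset v.
  exists (to_free 1 << (c * s) *g (v |` [fset u])%fset >>).
  rewrite free_diff_to_free; last first.
    move=> T /dom_freegU_sub ->; apply: one_fiberU1.
    + split; first by rewrite cardfs1.
      by move=> a b /fset1P -> /fset1P ->.
    + by rewrite inE eq_sym.
    + by move=> a /fset1P ->.
  rewrite (freegUZ (c * s)) -scalerA [boundary _]linearZ /= boundary_edge //.
  rewrite [in RHS]scalerBr -!(freegUZ c) freegUN to_freeD !to_free_vertex.
  by rewrite -scalerDl scaleNr -scalerBr.
elim/freeg_mpoly_ind: y => [|y z hy hz|c m e].
- by rewrite !linear0.
- by rewrite !linearD hy hz addr0.
rewrite !linearZ /= free_diffU; suff -> :
  free_augm (to_free 0 (boundary << cell_set e >>)) = 0.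
  by rewrite scaler0.
have [[e2 edeg] _] := cellP e.
have [u ue] : exists u, u \in cell_set e by apply/fset0Pn/cell_neq0.
have /cardfs1P[v ev] : #|` (cell_set e `\ u)%fset| == 1%N.
  by move: e2; rewrite (cardfsD1 u (cell_set e)) ue => -[/eqP].
have eE : cell_set e = (u |` [fset v])%fset by rewrite -ev fsetD1K.
have ve : v \in cell_set e by rewrite eE !inE eqxx orbT.
have vu : v != u.
  by have : v \in (cell_set e `\ u)%fset by [rewrite ev inE];
    rewrite !inE => /andP[].
pose s := face_sign k [fset v]%fset u.
(* The sign squares to 1; it is inserted to reach the form of [boundary_edge]. *)
have -> : << cell_set e >> = s *: (s *: << (u |` [fset v])%fset >>) :> C.
  by rewrite scalerA face_sign_sqr scale1r eE.
rewrite [boundary _]linearZ /= boundary_edge // scalerBr -!(freegUZ s) freegUN.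
rewrite to_freeD.
rewrite !to_free_vertex linearD !free_augmE -quotient_mapD.
apply/quotient_map_eq0/ideal_spanP; exists [:: (s%:MP, 'X_[v] - 'X_[u])].
  move=> t; rewrite inE => /eqP ->; exists v, u; split=> //.
  exact/degA_eq/edeg.
by rewrite big_seq1 /= mul_mpolyC scaleNr -scalerBr.
Qed.

Definition fiber_resolution :
  graded_free_resolution (@lattice_ring_homog k n L) :=
  GradedFreeResolution
    (fun i e => degA_in_semigroup _ : in_semigroup (@cell_deg i e))
    free_augm_homog free_diff_homog
    free_augm_surj free_augm_exact free_diff_exact.

End FiberResolution.

(** * Finiteness of fibers and the relative homology *)

Lemma nondecreasing_subsequence (g : nat -> nat) :
  exists2 phi : nat -> nat, {homo phi : i j / (i < j)%N}
    & {homo g \o phi : i j / (i <= j)%N}.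
Proof.
(* Past every [N] there is an index minimizing [g] on the rest of the sequence; iterating this
   choice gives the subsequence. *)
have minP N : exists m, (N <= m)%N /\ forall m', (N <= m')%N -> (g m <= g m')%N.
  apply: contrapT => H; have [v] := ubnP (g N).
  suff: forall v m, (N <= m)%N -> ~ (g m < v)%N by move=> /[apply]; apply.
  elim=> // {}v IH m Nm; rewrite ltnS => gmv; apply: H; exists m;
    split=> // m' Nm'.
  by rewrite leqNgt; apply/negP => gm'; apply: (IH m') => //;
    apply: leq_trans gmv.
have [next nextP] := choice minP.
pose phi := fix phi i := if i is j.+1 then next (phi j).+1 else next 0%N.
have phi_lt i : (phi i < phi i.+1)%N by case: (nextP (phi i).+1).
have phi_homo : {homo phi : i j / (i < j)%N}
  by apply: homo_ltn => //; apply: ltn_trans.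
exists phi => // i j; rewrite leq_eqVlt => /predU1P[-> //|/phi_homo ij].
case: i ij => [|i] ij /=; first by case: (nextP 0%N) => _; apply.
by case: (nextP (phi i).+1) => _; apply; apply: leq_trans (ltnW ij);
  apply: phi_lt.
Qed.

Lemma dickson n (f : nat -> 'X_{1..n}) :
  exists i j, (i < j)%N /\ (f i <= f j)%MM.
Proof.
have [phi phi_homo mono] :
    exists2 phi : nat -> nat, {homo phi : i j / (i < j)%N}
    & forall c, c \in enum 'I_n ->
        {homo (fun i => f (phi i) c) : i j / (i <= j)%N}.
  elim: (enum 'I_n) => [|c s [phi phi_homo mono]]; first by exists id.
  have [psi psi_homo psi_mono] :=
    nondecreasing_subsequence (fun i => f (phi i) c).
  exists (phi \o psi) => [i j /psi_homo/phi_homo //|c'].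
  rewrite inE => /predU1P[-> //|c's] i j;
    rewrite leq_eqVlt => /predU1P[-> //|/psi_homo ij].
  exact/(mono c' c's)/ltnW.
exists (phi 0%N), (phi 1%N); split; first exact: phi_homo.
by apply/mnm_lepP => c; apply: mono; rewrite ?mem_enum.
Qed.

(** An infinite fiber contains a sequence of distinct monomials. By Dickson's lemma an earlier one
    divides a later one, and the exponent of their quotient lies in [L], hence is 0: the two
    coincide. *)
Lemma finite_fiber n (L : zmodClosed 'rV[int]_n) (b : {quot L}) :
    (forall u : 'X_{1..n}, exponent u \in L -> u = 0%MM) ->
  exists E : {fset 'X_{1..n}}, forall u, degA L u = b -> u \in E.
Proof.
move=> hL; apply: contrapT => infinite.
have fresh (s : seq 'X_{1..n}) : exists u, degA L u = b /\ u \notin s.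
  apply: contrapT => H; apply: infinite; exists [fset u in s]%fset => u ub.
  by rewrite inE /=; apply/negPn/negP => us; apply: H; exists u.
have [next nextP] := choice fresh.
pose pre := fix pre i := if i is j.+1 then next (pre j) :: pre j else [::].
pose f i := next (pre i).
have fpre i j : (i < j)%N -> f i \in pre j.
  elim: j => // j IH; rewrite ltnS leq_eqVlt /= inE => /predU1P[->|/IH ->].
    by rewrite eqxx.
  by rewrite orbT.
have [i [j [ij fij]]] := dickson f.
have [fjb /negP] := nextP (pre j); rewrite -/(f j); apply.
have [fib _] := nextP (pre i).
suff /hL d0 : exponent (f j - f i)%MM \in L.
  by rewrite -(submK fij) d0 add0m fpre.
have -> : exponent (f j - f i)%MM = exponent (f j) - exponent (f i).
  apply/rowP => c; rewrite !mxE mnmBE subzn //; exact/mnm_lepP.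
by apply/degA_eq; rewrite fjb.
Qed.

(** * The pair of the full simplex on a fiber and its gcd complex *)

Section RelativeHomology.
Context (k : fieldType) (n : nat) (L : zmodClosed 'rV[int]_n) (b : {quot L}).
Local Notation R := {mpoly k[n]}.
Local Notation X := 'X_{1..n}.
Local Notation C := {freeg {fset X} / k}.
Local Notation cell := (cell L).
Local Notation G := (fiber_resolution k L).
Implicit Types (i m : nat) (T S : {fset X}) (c : C).

(** On chains over one fiber this is the projection to relative chains; [cell_incl] is a section of
    it, not a chain map. *)
Definition cell_part i : {linear C -> {freeg (cell i) / k}} :=
  fglift (fun T => if to_cell L i T is Some e then << e >> else 0).

Definition cell_incl i : {linear {freeg (cell i) / k} -> C} :=
  fglift (fun e => << cell_set e >>).

Lemma cell_partU i T :
  cell_part i << T >> = if to_cell L i T is Some e then << e >> else 0.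
Proof. exact: fgliftU1. Qed.

Lemma cell_inclU i (e : cell i) : cell_incl i << e >> = << cell_set e >>.
Proof. exact: fgliftU1. Qed.

Lemma cell_inclK i : cancel (cell_incl i) (cell_part i).
Proof.
move=> z; pose f : {linear {freeg (cell i) / k} -> {freeg (cell i) / k}} :=
  cell_part i \o cell_incl i.
rewrite -[LHS]/(f z) -[RHS]/((idfun : {linear _ -> _}) z).
apply: linear_freeg_eq => e.
by rewrite /f /= cell_inclU cell_partU to_cellK.
Qed.

Lemma coeff_cell_part i (e : cell i) c :
  coeff e (cell_part i c) = coeff (cell_set e) c.
Proof.
elim/freeg_ind_add: c => [|x y|a T].
- by rewrite linear0 !coeff0.
- by rewrite linearD !coeffD => -> ->.
rewrite freegUZ linearZ /= !coeffZ cell_partU coeffU mul1r.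
case: to_cellP => [e' <-|nT];
  first by rewrite coeffU mul1r (inj_eq (@cell_set_inj _ _ _)).
rewrite coeff0; case: eqP => // TE; case: nT; rewrite TE; exact: cellP.
Qed.

Lemma cell_part_eq0 i c :
    (forall T, T \in dom c -> gcd_face b T) -> cell_part i c = 0.
Proof.
move=> hc; rewrite -[RHS]/((\0 : {linear C -> {freeg (cell i) / k}}) c).
apply: linear_freeg_eq_dom => T /hc hT; rewrite cell_partU.
case: to_cellP => // e eT; have [_ e0] := cellP e.
case: hT => [T0|[_ _ []]]; last by rewrite -eT.
by have := cell_neq0 e; rewrite eT T0 eqxx.
Qed.

Lemma reduce_mod_to_free i c :
  fiber_chain L i c -> reduce_mod (to_free L i c) = cell_part i c.
Proof.
move=> hc; elim/freeg_ind_dom: c / hc => [|x y hx hy|a T hT].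
- by rewrite to_free0 reduce_mod0 linear0.
- by rewrite to_freeD reduce_modD linearD hx hy.
have [e eT ->] := to_freeU a hT.
rewrite reduce_modZ reduce_modU (freegUZ a) [RHS]linearZ /= cell_partU.
rewrite meval_at0 mcoeffZ mcoeffX.
have [T0|T0] := eqVneq (mgcds T) 0%MM.
  have TE : T = cell_set e by rewrite eT -[LHS]stripK T0 translate0.
  by rewrite mulr1 [in RHS]TE to_cellK.
rewrite mulr0 scale0r; case: to_cellP => [e' e'T|]; last by rewrite scaler0.
by case: (cellP e') => _; rewrite e'T => /eqP; rewrite (negPf T0).
Qed.

Lemma tensor_free_diff i (z : {freeg (cell i.+1) / k}) :
  tensor_k (free_diff k L i) z = cell_part i (boundary (cell_incl i.+1 z)).
Proof.
pose f : {linear {freeg (cell i.+1) / k} -> {freeg (cell i) / k}} :=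
  cell_part i \o (@boundary _ X k \o cell_incl i.+1).
rewrite -[RHS]/(f z); apply: linear_freeg_eq => e.
rewrite /f /= cell_inclU [LHS]fgliftU1 free_diffU reduce_mod_to_free //.
apply: fiber_chain_boundary => T /dom_freegU_sub ->.
by case: (cellP e).
Qed.

(** A set without common divisor only has supersets without one. So a non-cell in one fiber has no
    facet that is a cell, and [cell_part] commutes with the differentials. *)
Lemma tensor_free_diff_part i c : fiber_chain L i.+1 c ->
  tensor_k (free_diff k L i) (cell_part i.+1 c) = cell_part i (boundary c).
Proof.
move=> hc; rewrite tensor_free_diff.
pose f : {linear C -> {freeg (cell i) / k}} :=
  cell_part i \o (@boundary _ X k \o (cell_incl i.+1 \o cell_part i.+1)).
pose g : {linear C -> {freeg (cell i) / k}} := cell_part i \o @boundary _ X k.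
rewrite -[LHS]/(f c) -[RHS]/(g c); apply: linear_freeg_eq_dom => T /hc hT.
rewrite /f /g /= cell_partU.
case: to_cellP => [e <-|nT]; first by rewrite cell_inclU.
rewrite !linear0.
rewrite -[LHS]/((\0 : {linear C -> {freeg (cell i) / k}}) (boundary << T >>)).
apply: linear_freeg_eq_dom => S /dom_boundaryU[v vT SE]; rewrite cell_partU /=.
case: to_cellP => // e eS; have [_ e0] := cellP e; case: nT; split=> //.
have ST : (S `<=` T)%fset by rewrite SE fsubsetDl.
have S0 : S != fset0 by rewrite -eS cell_neq0.
apply/mnmP => j; rewrite mnm0E; apply/eqP; rewrite -leqn0.
have <- : mgcds S j = 0%N by rewrite -eS e0 mnm0E.
rewrite (leq_mgcds j _ (fset_neq_nil S0)); apply/allP => u uS.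
by apply/mnm_lepP/mgcds_le; move/fsubsetP: ST; apply.
Qed.

(** Indexed by cardinality instead of dimension, so that the empty face is covered by [m = 0]. *)
Definition in_fiber m c := forall T, T \in dom c ->
  #|` T| = m /\ forall u, u \in T -> degA L u = b.

Lemma in_fiber_chain i c : in_fiber i.+1 c -> fiber_chain L i c.
Proof.
move=> hc T /hc[Ti Tb]; split=> // u v uT vT.
by rewrite !Tb.
Qed.

Lemma in_fiberB m c c' : in_fiber m c -> in_fiber m c' -> in_fiber m (c - c').
Proof. by move=> hc hc' T /domB; rewrite mem_cat => /orP[/hc|/hc']. Qed.

Lemma in_fiber_boundary m c : in_fiber m.+1 c -> in_fiber m (boundary c).
Proof.
move=> hc; apply: (dom_fglift_sub (D := fun T => #|` T| = m.+1 /\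
  forall u, u \in T -> degA L u = b)) => // T [Tm Tb] S hS.
have /dom_boundaryU[v vT ->] : S \in dom (boundary (<< T >> : C)).
  by rewrite boundaryU.
split; first by move: Tm; rewrite (cardfsD1 v) vT => -[].
by move=> u; rewrite !inE => /andP[_]; apply: Tb.
Qed.

Lemma in_fiber_cone p m c : degA L p = b ->
  in_fiber m c -> in_fiber m.+1 (cone k p c).
Proof.
move=> pb hc; apply: (dom_fglift_sub (D := fun T => #|` T| = m /\
  forall u, u \in T -> degA L u = b)) => // T [Tm Tb] S.
case: ifP => pT; first by rewrite dom0.
rewrite -freegUZ => /dom_freegU_sub ->; split; first by rewrite cardfsU1 pT Tm.
by move=> u; rewrite !inE => /predU1P[->|/Tb].
Qed.

Lemma cell_part_homog m i c : in_fiber m c ->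
  tensor_homog (F := G) (i := i) b (cell_part i c).
Proof.
move=> hc e; rewrite mem_dom coeff_cell_part -mem_dom => /hc[_]; apply.
exact/head_fset/cell_neq0.
Qed.

Lemma cell_incl_in_fiber i (z : {freeg (cell i) / k}) :
  tensor_homog (F := G) (i := i) b z -> in_fiber i.+1 (cell_incl i z).
Proof.
move=> hz.
apply: (dom_fglift_sub (D := fun e : cell i => cell_deg e = b)) => // e eb T.
move=> /dom_freegU_sub ->; have [[ei _] _] := cellP e; split=> // u ue.
by rewrite -eb (cell_degE ue).
Qed.

Lemma gcd_faceP i c : in_fiber i.+1 c -> cell_part i c = 0 ->
  forall T, T \in dom c -> gcd_face b T.
Proof.
move=> hc c0 T Tc; have [Ti Tb] := hc T Tc.
have hT : one_fiber L i T by exact: in_fiber_chain Tc.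
right; split=> //; first exact: one_fiber_neq0 hT.
move=> T0; have [e eT|[]] := to_cellP L i T; last by split.
by move: Tc; rewrite mem_dom -eT -coeff_cell_part c0 coeff0 eqxx.
Qed.

Lemma chainP (j : int) m c : j + 1 = m%:Z ->
  chain (gcd_complex b) j c <->
  in_fiber m c /\ forall T, T \in dom c -> gcd_face b T.
Proof.
move=> jm; rewrite /chain jm; split=> [hc|[hc hf] T Tc].
  split=> T /hc[] //= fT [Tm]; split=> // u uT.
  by case: fT => [T0|[_ /(_ u uT)]] //; rewrite T0 in uT.
by split; [exact: hf|case: (hc T Tc) => ->].
Qed.

Lemma chain_subspace (D : simplicial_complex X) (j : int) :
  subspace (fun c : C => chain D j c).
Proof.
split; first by move=> T; rewrite dom0.
by move=> a u v; apply: dom_linearP.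
Qed.

Lemma reduced_cycle_subspace (D : simplicial_complex X) (j : int) :
  subspace (fun c : C => chain D j c /\ boundary c = 0).
Proof.
have [ch0 chD] := chain_subspace D j; split; first by rewrite linear0.
move=> a u v [cu bu] [cv bv]; split; first exact: chD.
by rewrite linearP /= bu bv scaler0 addr0.
Qed.

Lemma reduced_boundary_subspace (D : simplicial_complex X) (j : int) :
  subspace (fun c : C => exists2 c', chain D (j + 1) c' & c = boundary c').
Proof.
have [ch0 chD] := chain_subspace D (j + 1); split.
  by exists 0; rewrite ?linear0.
move=> a _ _ [u cu ->] [v cv ->]; exists (a *: u + v); first exact: chD.
by rewrite linearP.
Qed.

(** All faces are subsets of one finite fiber, so the chains lie in the span of finitely many
    generators. *)
Lemma reduced_homology_finite (j : int) :
    (forall u : X, exponent u \in L -> u = 0%MM) ->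
  exists d, reduced_homology_dim k (gcd_complex b) j d.
Proof.
move=> /(finite_fiber b)[E Eb]; pose s : seq {fset X} := fpowerset E.
apply: (has_dim_quotient_exists
  (g := fun l : 'I_(size s) => << nth fset0 s l >>)).
- exact: reduced_cycle_subspace.
- exact: reduced_boundary_subspace.
move=> c [cj _]; exists (fun l => coeff (nth fset0 s l) c).
have aD T : {morph (fun a : k => << a *g T >> : C) : x y / x + y}.
  by move=> x y; rewrite freegUD.
rewrite -{1}(freeg_sumE c) -[LHS]/(fgsum (fun T (a : k) => << a *g T >>) c).
rewrite (fgsum_widen aD (s := s)); first last.
- move=> T /cj[fT _]; rewrite fpowersetE; apply/fsubsetP => u uT; apply: Eb.
  by case: fT => [T0|[_ + _]]; [rewrite T0 in uT|apply].
- exact: fset_uniq.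
rewrite (big_nth fset0) big_mkord; apply: eq_bigr => l _; exact: freegUZ.
Qed.

(* The connecting isomorphism of the pair (full simplex on the fiber, gcd
   complex), inverted by means of the cone contraction of the full simplex. *)
Lemma tensor_fiber_resolution_dim p i d : degA L p = b ->
    reduced_homology_dim k (gcd_complex b) (i%:Z - 1) d ->
  tensor_homology_dim G i b d.
Proof.
move=> pb; have j1 : i%:Z - 1 + 1 = i%:Z by rewrite subrK.
have j2 : i%:Z - 1 + 1 + 1 = i.+1%:Z by rewrite subrK -addn1 PoszD.
have tD l : tensor_k (diff G l) = tensor_k (free_diff k L l) :> (_ -> _) by [].
have coneE c : boundary (cone k p c) = c - cone k p (boundary c).
  by rewrite -{2}(boundary_cone p c) addrK.
pose f : {linear C -> {freeg (cell i) / k}} := cell_part i \o cone k p.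
apply: (has_dim_quotient_iso (f := f)).
- exact: reduced_cycle_subspace.
- split; first by exists 0; rewrite ?linear0 /tensor_k ?linear0 // => e;
  rewrite dom0.
  move=> a _ _ [u ub ->] [v vb ->]; exists (a *: u + v).
    exact: (tensor_homog_subspace G i.+1 b).2.
  by rewrite /tensor_k linearP.
- move=> w [/(chainP _ j1)[wi wf] w0].
  have cw := in_fiber_cone pb wi; split; first exact: cell_part_homog cw.
  case: i {j1 j2} wi @f cw => [|i] wi f cw //=.
  rewrite -[LHS]/(tensor_k (free_diff k L i) _) tensor_free_diff_part.
    by rewrite coneE w0 linear0 subr0; apply: cell_part_eq0.
  exact: in_fiber_chain.
- move=> w [/(chainP _ j1)[wi wf] w0]; split.
    case=> c' /(chainP _ j2)[ci cf] wE; have cc := in_fiber_cone pb ci.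
    (* If [w] bounds [c'], the boundary of [- cone k p c'] is the cone of [w] minus [c'], and [c']
       dies in the relative chains. *)
    have cN : in_fiber i.+2 (- cone k p c') by move=> T; rewrite domN => /cc.
    exists (cell_part i.+1 (- cone k p c')); first exact: cell_part_homog cN.
    rewrite tD tensor_free_diff_part; last exact: in_fiber_chain.
    rewrite [boundary _]linearN /= coneE -wE opprB linearB /=.
    by rewrite [X in _ - X]cell_part_eq0 // subr0.
  case=> y yb fy; have yi := cell_incl_in_fiber yb.
  have cw := in_fiber_cone pb wi.
  (* The relative part of this chain is zero by [fy], so it lies in the gcd complex; its boundary is
     [w]. *)
  exists (cone k p w - boundary (cell_incl i.+1 y)).
    apply/(chainP _ j2); have ci := in_fiberB cw (in_fiber_boundary yi).
    split=> //; apply: (gcd_faceP ci).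
    by rewrite linearB /= -tensor_free_diff -tD -fy subrr.
  by rewrite linearB /= boundary_boundary subr0 coneE w0 linear0 subr0.
- move=> z [zb zc]; have zi := cell_incl_in_fiber zb.
  (* The connecting map: lift the relative cycle to the full simplex and take the boundary. Coning
     this recovers the lift up to the boundary of its cone. *)
  exists (boundary (cell_incl i z)).
    split; last exact: boundary_boundary.
    apply/(chainP _ j1); have bi := in_fiber_boundary zi; split=> //.
    case: i {j1 j2 f} z zb zc zi bi => [|i] z zb zc zi bi.
      (* For [i = 0] the boundary is supported on the empty face, which always belongs to the
         complex. *)
      by move=> T /bi[/cardfs0_eq -> _]; left.
    by apply: (gcd_faceP bi); rewrite -tensor_free_diff.
  have ci := in_fiber_cone pb zi.
  exists (cell_part i.+1 (cone k p (cell_incl i z)));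
    first exact: cell_part_homog ci.
  rewrite tD tensor_free_diff_part; last exact: in_fiber_chain.
  by rewrite /f /= coneE linearB /= cell_inclK.
Qed.

End RelativeHomology.

Theorem corollary3p3 (n : nat) (k : fieldType) (L : zmodClosed 'rV[int]_n)
    (hL : forall u : 'X_{1..n}, exponent u \in L -> u = 0%MM)
    (b : {quot L}) (hb : in_semigroup b) (i : nat) :
  exists2 d : nat,
    betti_number k i b d &
    reduced_homology_dim k (gcd_complex b) (i%:Z - 1) d.
Proof.
have [d hd] := reduced_homology_finite k b (i%:Z - 1) hL.
exists d => //; split; first exact: inhabits (fiber_resolution k L).
move=> F; apply: (tensor_homology_dim_indep (@lattice_ring_cover k n L)).
have [c bE] := hb.
(* The expression of [b] through the generators gives a monomial of degree [b], the apex of the cone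
   over the fiber. *)
apply: (@tensor_fiber_resolution_dim _ _ _ _ [multinom c i | i < n]) hd.
by rewrite bE; apply: eq_bigr => j _; rewrite mnmE.
Qed.
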